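(* Let $n\ge 2$ and let $F=u\,\phi(r,s)$ be a spherically symmetric Finsler metric on the ball $\mathbb{B}^n(r_0)\subset\mathbb{R}^n$, with geodesic spray determined by the functions $P(r,s)$ and $Q(r,s)$ and with Riemann curvature $R^i_j$ (see context). Then the curvature compatibility condition $d_RF=0$ on $F$, i.e. $R^i_j\,\frac{\partial F}{\partial y^i}=0$ for all $j$ (a condition which $F$ satisfies), is given by $$\phi_s R_1+\bigl(s\phi+(r^2-s^2)\phi_s\bigr)R_3+\phi R_5=0 .$$ In other words, this identity between $\phi$, $R_1$, $R_3$, $R_5$ holds for $F$, and it expresses the condition $R^i_j\,\frac{\partial F}{\partial y^i}=0$.
   Context: Notation: for $x\in\mathbb{B}^n(r_0)$ (the open ball of radius $r_0$ centred at $0$) and $y\in\mathbb{R}^n\setminus\{0\}$ put $r=|x|$, $u=|y|$, $s=\langle x,y\rangle/|y|$ (Euclidean norm and inner product). Subscripts $r,s$ on functions of $(r,s)$ denote partial derivatives. Summation over repeated indices is understood. A Finsler metric $F$ is a function on the tangent bundle that is positive and smooth for $y\neq 0$, positively homogeneous of degree 1 in $y$, and such that $g_{jk}=\frac12\frac{\partial^2F^2}{\partial y^j\partial y^k}$ has rank $n$ for $y\ne0$. It is spherically symmetric if $F=u\,\phi(r,s)$ with $\phi$ a positive smooth function (defined for $|s|\le r<r_0$). Such an $F$ is regular iff $\phi-s\phi_s+(r^2-s^2)\phi_{ss}>0$ and, when $n\ge3$, also $\phi-s\phi_s>0$, for all $|s|\le r<r_0$. The geodesic spray of $F$ is $S=y^i\frac{\partial}{\partial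 x^i}-2G^i\frac{\partial}{\partial y^i}$ with $G^i=uP\,y^i+u^2Q\,x^i$, where $$Q=\frac{1}{2r}\,\frac{-\phi_r+s\phi_{rs}+r\phi_{ss}}{\phi-s\phi_s+(r^2-s^2)\phi_{ss}},\qquad P=-\frac{Q}{\phi}\bigl(s\phi+(r^2-s^2)\phi_s\bigr)+\frac{1}{2r\phi}(s\phi_r+r\phi_s).$$ With $G^i_j=\partial G^i/\partial y^j$, the Riemann curvature (Jacobi endomorphism) is $R=R^i_j\,dx^j\otimes\frac{\partial}{\partial y^i}$, $R^i_j=2\frac{\partial G^i}{\partial x^j}-S(G^i_j)-G^i_kG^k_j$, and $d_RF$ is the one-form $R^i_j\frac{\partial F}{\partial y^i}dx^j$. All identities are understood where $x\ne0$, $y\neq0$. Define $$R_1=2Q-\tfrac{s}{r}P_r-P_s+2(r^2-s^2)P_sQ+P^2+2sPQ,$$ $$R_3=\tfrac{2}{r}Q_r-Q_{ss}-\tfrac{s}{r}Q_{rs}+2(r^2-s^2)QQ_{ss}+4Q^2-(r^2-s^2)Q_s^2-2sQQ_s,$$ $$R_5=\tfrac{2}{r}P_r-\tfrac{s}{r}P_{rs}-P_{ss}-Q_s+2PQ-2sP_sQ+2(r^2-s^2)P_{ss}Q-PP_s-sPQ_s-(r^2-s^2)P_sQ_s.$$ Moreover $R^i_j=u^2R_1\delta^i_j+R_2y^iy_j+u^2R_3x^ix_j+uR_4x^iy_j+uR_5x_jy^i$ with $R_4=-sR_3$ and $R_2=-R_1-sR_5$, where $x_i=x^i$, $y_i=y^i$.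 *)

(* Defs.v *)
From HB Require Import structures.
From mathcomp Require Import all_boot all_order all_algebra.
From mathcomp Require Import all_classical all_reals all_analysis.

Set Implicit Arguments.
Unset Strict Implicit.
Unset Printing Implicit Defensive.

Import Order.TTheory GRing.Theory Num.Theory.
Import numFieldNormedType.Exports.

Local Open Scope classical_set_scope.
Local Open Scope ring_scope.

(* The library norm `|x| on 'rV[R]_n is the max norm, hence [enorm]. *)
Definition dot (R : realType) (n : nat) (x y : 'rV[R]_n) : R :=
  \sum_(i < n) x 0 i * y 0 i.

Definition enorm (R : realType) (n : nat) (x : 'rV[R]_n) : R :=
  Num.sqrt (dot x x).

Section Smoothness.
Variables (R : realType) (V : normedModType R).

Fixpoint iter_derive (f : V -> R) (vs : seq V) : V -> R :=
  if vs is v :: vs' then fun p => 'D_v (iter_derive f vs') p else f.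

(* C^oo on a set that need not be open: C^oo on some open neighbourhood of it. *)
Definition smooth_on (A : set V) (f : V -> R) : Prop :=
  exists2 U : set V, open U /\ A `<=` U &
    forall (vs : seq V) (p : V), U p -> differentiable (iter_derive f vs) p.

End Smoothness.

(* Functions f : 'rV_n -> 'rV_n -> R are read as f x y, with y a tangent vector
   at the point x. *)
Section SlitTangentBundle.
Variables (R : realType) (n : nat).
Implicit Types (f F : 'rV[R]_n -> 'rV[R]_n -> R) (x y : 'rV[R]_n).

Definition partial_x (j : 'I_n) f x y : R := 'D_(delta_mx 0 j) (f ^~ y) x.

Definition partial_y (j : 'I_n) f x y : R := 'D_(delta_mx 0 j) (f x) y.

Definition fundamental_tensor F x y : 'M[R]_n :=
  \matrix_(j, k)
    (2^-1 * partial_y j (partial_y k (fun x' y' => F x' y' ^+ 2)) x y).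

Record finsler_metric (r0 : R) F : Prop := FinslerMetric {
  finsler_pos : forall x y, enorm x < r0 -> y != 0 -> 0 < F x y;
  finsler_smooth : smooth_on
    [set p : 'rV[R]_n * 'rV[R]_n | enorm p.1 < r0 /\ p.2 != 0]
    (fun p => F p.1 p.2);
  finsler_homogeneous : forall x y (a : R), enorm x < r0 -> y != 0 -> 0 < a ->
    F x (a *: y) = a * F x y;
  finsler_rank : forall x y, enorm x < r0 -> y != 0 ->
    \rank (fundamental_tensor F x y) = n }.

Definition svar x y : R := dot x y / enorm y.

Record spherically_symmetric (r0 : R) (phi : R -> R -> R) F : Prop :=
  SphericallySymmetric {
  spherical_pos : forall r s, `|s| <= r < r0 -> 0 < phi r s;
  spherical_smooth : smooth_on [set p : R * R | `|p.2| <= p.1 < r0]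
    (fun p => phi p.1 p.2);
  sphericalE : forall x y, enorm x < r0 -> y != 0 ->
    F x y = enorm y * phi (enorm x) (svar x y) }.

End SlitTangentBundle.

Section RadialFunctions.
Variable R : realType.
Implicit Types f phi : R -> R -> R.

Definition dr f (r s : R) : R := derive1 (f ^~ s) r.

Definition ds f (r s : R) : R := derive1 (f r) s.

Definition Qfun phi (r s : R) : R :=
  (2 * r)^-1 *
  ((- dr phi r s + s * ds (dr phi) r s + r * ds (ds phi) r s) /
   (phi r s - s * ds phi r s + (r ^+ 2 - s ^+ 2) * ds (ds phi) r s)).

Definition Pfun phi (r s : R) : R :=
  - (Qfun phi r s / phi r s) *
    (s * phi r s + (r ^+ 2 - s ^+ 2) * ds phi r s) +
  (2 * r * phi r s)^-1 * (s * dr phi r s + r * ds phi r s).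

Definition R1fun phi (r s : R) : R :=
  let P := Pfun phi in let Q := Qfun phi in
  2 * Q r s - s / r * dr P r s - ds P r s
  + 2 * (r ^+ 2 - s ^+ 2) * ds P r s * Q r s
  + P r s ^+ 2 + 2 * s * P r s * Q r s.

Definition R3fun phi (r s : R) : R :=
  let Q := Qfun phi in
  2 / r * dr Q r s - ds (ds Q) r s - s / r * ds (dr Q) r s
  + 2 * (r ^+ 2 - s ^+ 2) * Q r s * ds (ds Q) r s
  + 4 * Q r s ^+ 2 - (r ^+ 2 - s ^+ 2) * ds Q r s ^+ 2
  - 2 * s * Q r s * ds Q r s.

Definition R5fun phi (r s : R) : R :=
  let P := Pfun phi in let Q := Qfun phi in
  2 / r * dr P r s - s / r * ds (dr P) r s - ds (ds P) r s - ds Q r s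
  + 2 * P r s * Q r s - 2 * s * ds P r s * Q r s
  + 2 * (r ^+ 2 - s ^+ 2) * ds (ds P) r s * Q r s
  - P r s * ds P r s - s * P r s * ds Q r s
  - (r ^+ 2 - s ^+ 2) * ds P r s * ds Q r s.

End RadialFunctions.

Section Curvature.
Variables (R : realType) (n : nat) (phi : R -> R -> R).
Implicit Types (f F : 'rV[R]_n -> 'rV[R]_n -> R) (x y : 'rV[R]_n).

Definition spray_coef (i : 'I_n) x y : R :=
  enorm y * Pfun phi (enorm x) (svar x y) * y 0 i
  + enorm y ^+ 2 * Qfun phi (enorm x) (svar x y) * x 0 i.

Definition spray f x y : R :=
  \sum_(k < n) y 0 k * partial_x k f x y
  - 2 * \sum_(k < n) spray_coef k x y * partial_y k f x y.

Definition connection_coef (i j : 'I_n) : 'rV[R]_n -> 'rV[R]_n -> R :=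
  partial_y j (spray_coef i).

Definition riemann_curvature (i j : 'I_n) x y : R :=
  2 * partial_x j (spray_coef i) x y - spray (connection_coef i j) x y
  - \sum_(k < n) connection_coef i k x y * connection_coef k j x y.

(* The coefficient of dx^j in the one-form d_R F. *)
Definition d_R F (j : 'I_n) x y : R :=
  \sum_(i < n) riemann_curvature i j x y * partial_y i F x y.

End Curvature.

(* Main.v *)
Require Import Defs.
From HB Require Import structures.
From mathcomp Require Import all_boot all_order all_algebra.
From mathcomp Require Import all_classical all_reals all_analysis.
From mathcomp Require Import ring lra.
Import Order.TTheory GRing.Theory Num.Theory.
Import numFieldNormedType.Exports.
Local Open Scope classical_set_scope.
Local Open Scope ring_scope.

Set Implicit Arguments.
Unset Strict Implicit.

(* The coefficients P and Q are chosen so that F is parallel for the horizontal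
   distribution of its spray: F_{x^j} = G^i_j F_{y^i}.  For F = u phi(r, s) this
   system consists of two first order equations between phi, P and Q, which follow
   algebraically from the definitions of P and Q (after one differentiation
   in s).  Differentiating F_{x^j} = G^i_j F_{y^i} once more along the spray gives
   R^i_j F_{y^i} = 0; differentiating the two scalar equations once more and
   eliminating gives the identity between phi, R1, R3 and R5.  The pointwise
   equivalence holds because both sides do.  The common denominator of P and Q
   does not vanish, even on the boundary |s| = r, because the fundamental tensor
   has full rank. *)

(** Write E2 and E1 for the left sides of [radial_spray] and [radial_horizontal]. The formula for P
    is E2 = 0 solved for P, and the formula for Q is exactly what makes dE2/ds equal to 2 E1. The
    link with the metric is F_{x^j} - G^i_j F_{y^i} = u x_j E1 + y_j (E2 - s E1), where the sum over
    i is contracted through y^i F_{y^i} = u phi and x^i F_{y^i} = [Wfun]. The integrability argument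
    is then carried out in two settings, on the slit tangent bundle and in the plane of (r, s); on
    functions of (r, s) the spray acts as u times (s/r) d/dr + (1 - 2 (r^2 - s^2) Q) d/ds. Two
    obstacles shape the text. Second derivatives of F and mixed derivatives of phi, P and Q have to
    be commuted, which calls for a class of smooth functions closed under the operations that build
    P and Q. Moreover the cone |s| <= r is closed, while derivatives are two-sided and an identity
    can be differentiated only where it holds on an open set. *)

Lemma ler_dist_split (R : realFieldType) (e a b c : R) :
  `|a - c| < e / 2 -> `|b - c| < e / 2 -> `|a - b| <= e.
Proof.
by rewrite !ltr_norml ler_norml => /andP[? ?] /andP[? ?]; apply/andP; split; lra.
Qed.

(** * Directional derivatives and smooth functions *)

Section DerivationRules.
Variables (R : realType) (V : normedModType R).
Implicit Types (f g : V -> R) (p v : V).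

(** The first order expansion of [f] at [p] is also one of [g], and uniqueness of the differential
    identifies its linear part with ['d g p]. *)
Lemma near_eq_differentiable f g p :
  (\forall q \near p, f q = g q) -> differentiable f p -> differentiable g p.
Proof.
move=> fg df; have fgp : f p = g p := nbhs_singleton fg.
have Hg : g \o shift p = cst (g p) + 'd f p +o_ (0 : V) id.
  apply/eqaddoP => _/posnumP[e].
  have /eqaddoP /(_ e%:num) /(_ [gt0 of e%:num]) := diff_locally df.
  have fg0 : \forall h \near (0 : V), f (h + p) = g (h + p).
    by move: fg; rewrite (near_shift 0) subr0.
  apply: filter_app; near=> h; rewrite /= fgp.
  rewrite -![(_ + _ : _ -> _) _]/(_ + _) -![(- _ : _ -> _) _]/(- _) /=.
  by have -> : f (h + p) = g (h + p) by near: h.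
have dfc := diff_continuous df.
have E := diff_unique dfc Hg.
by apply/diff_locallyP; rewrite E; split.
Unshelve. all: by end_near. Qed.

Lemma is_derive_add f g p v a b : is_derive p v f a -> is_derive p v g b ->
  is_derive p v (fun q => f q + g q) (a + b).
Proof. by move=> ? ?; apply: is_deriveD. Qed.

Lemma is_derive_sub f g p v a b : is_derive p v f a -> is_derive p v g b ->
  is_derive p v (fun q => f q - g q) (a - b).
Proof. by move=> ? ?; apply: is_deriveB. Qed.

Lemma is_derive_mul f g p v a b : is_derive p v f a -> is_derive p v g b ->
  is_derive p v (fun q => f q * g q) (a * g p + f p * b).
Proof.
move=> fa gb; have := @is_deriveM _ _ _ _ _ _ _ _ fa gb.
by rewrite addrC /GRing.scale /= [g p * a]mulrC.
Qed.

Lemma is_derive_sqr f p v a : is_derive p v f a ->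
  is_derive p v (fun q => f q ^+ 2) (2 * f p * a).
Proof.
move=> fa; have := is_derive_mul fa fa.
have -> : a * f p + f p * a = 2 * f p * a by ring.
by congr is_derive; apply/funext => q; rewrite expr2.
Qed.

Lemma is_derive_inv f p v a : f p != 0 -> is_derive p v f a ->
  is_derive p v (fun q => (f q)^-1) (- (f p) ^- 2 * a).
Proof.
move=> fp [df <-]; apply: DeriveDef; first exact: derivableV.
by rewrite deriveV.
Qed.

Lemma is_derive_const (c : R) p v : is_derive p v (fun=> c) 0.
Proof. exact: is_derive_cst. Qed.

Lemma is_derive_bigsum n (f : 'I_n -> V -> R) p v (a : 'I_n -> R) :
  (forall i, is_derive p v (f i) (a i)) ->
  is_derive p v (fun q => \sum_(i < n) f i q) (\sum_(i < n) a i).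
Proof.
move=> fa; have := @is_derive_sum _ _ _ n f p v a fa.
by congr is_derive; apply/funext => q; rewrite fct_sumE.
Qed.

Lemma is_derive_line f p v (t : R) : derivable f (t *: v + p) v ->
  is_derive t 1 (fun t => f (t *: v + p)) ('D_v f (t *: v + p)).
Proof.
move=> df.
have E : (fun h : R => h^-1 *: (f ((h *: 1 + t) *: v + p) - f (t *: v + p))) =
         (fun h : R => h^-1 *: (f (h *: v + (t *: v + p)) - f (t *: v + p))).
  by apply/funext => h; rewrite [h *: 1]mulr1 scalerDl addrA.
by apply: DeriveDef; rewrite /derivable /derive /= E.
Qed.

Lemma is_derive_lineP f p v a :
  is_derive p v f a <-> is_derive (0 : R) 1 (fun t => f (t *: v + p)) a.
Proof.
have E : (fun h : R => h^-1 *: (f ((h *: 1 + 0 : R) *: v + p) - f ((0 : R) *: v + p))) =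
         (fun h : R => h^-1 *: (f (h *: v + p) - f p)).
  by apply/funext => h; rewrite [h *: 1]mulr1 scale0r addr0 add0r.
split=> -[df <-]; apply: DeriveDef; move: df;
  by rewrite /derivable /derive /= ?E.
Qed.

Lemma is_derive_comp (h : R -> R) f p v a b : is_derive (f p) 1 h b ->
  is_derive p v f a -> is_derive p v (fun q => h (f q)) (b * a).
Proof.
move=> hb /is_derive_lineP fa; apply/is_derive_lineP.
by apply: is_derive1_comp; rewrite scale0r add0r.
Qed.

(** Full differentiability is asked of the outer function only. Restricted to the line through [p]
    along [v], the inner functions depend on one real variable, where derivable and differentiable
    coincide. *)
Lemma is_derive_comp2 (h : R * R -> R) f g p v a b :
  differentiable h (f p, g p) -> is_derive p v f a -> is_derive p v g b ->
  is_derive p v (fun q => h (f q, g q))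
    ('D_(1, 0) h (f p, g p) * a + 'D_(0, 1) h (f p, g p) * b).
Proof.
move=> dh /is_derive_lineP fa /is_derive_lineP gb; apply/is_derive_lineP.
set f1 := fun t : R => f (t *: v + p) in fa *.
set g1 := fun t : R => g (t *: v + p) in gb *.
have [/derivable1_diffP df fE] := fa; have [/derivable1_diffP dg gE] := gb.
have p0 : (f p, g p) = (f1 0, g1 0) by rewrite /f1 /g1 scale0r add0r.
rewrite p0 in dh *.
have dfg : differentiable (fun t => (f1 t, g1 t)) (0 : R).
  exact: differentiable_pair.
have dhfg : differentiable (h \o (fun t => (f1 t, g1 t))) (0 : R).
  exact: differentiable_comp.
apply: DeriveDef; first exact: diff_derivable.
rewrite !deriveE // in fE gE *; rewrite diff_comp //= diff_pair //= fE gE.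
have -> : (a, b) = a *: ((1, 0) : R * R) + b *: (0, 1).
  by congr (_, _); rewrite /= ?scaler0 ?addr0 ?add0r [_ *: _]mulr1.
by rewrite linearD !linearZ /= mulrC [X in _ + X]mulrC.
Qed.

Lemma mean_value_line f p v (h : R) : 0 < h ->
  (forall t, 0 <= t <= h -> derivable f (t *: v + p) v) ->
  exists2 t, 0 <= t <= h & f (h *: v + p) - f p = 'D_v f (t *: v + p) * h.
Proof.
move=> h0 df.
have [| |t tI E] := @MVT_segment R (fun t => f (t *: v + p))
    (fun t => 'D_v f (t *: v + p)) 0 h (ltW h0).
- move=> t; rewrite in_itv /= => /andP[t0 th]; apply: is_derive_line.
  by apply: df; rewrite !ltW.
- apply: derivable_within_continuous => t; rewrite in_itv /= => th.
  by have [] := is_derive_line (df t th).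
exists t; first by move: tI; rewrite in_itv.
by move: E; rewrite scale0r add0r subr0.
Qed.

End DerivationRules.

(** * Functions of class C^k on an open set and symmetry of mixed derivatives *)

Section Smooth.
Variables (R : realType) (V : normedModType R) (U : set V).
Hypothesis Uopen : open U.
Implicit Types (f g : V -> R) (p v : V).

(** Recursion on the order, with the innermost derivative taken first, lets closure under each
    operation follow by induction from its derivation rule. *)
Fixpoint Ck (k : nat) f : Prop :=
  (forall p, U p -> differentiable f p) /\
  (if k is k'.+1 then forall v, Ck k' ('D_v f) else True).

Definition Coo f := forall k, Ck k f.

(** [iter_derive] adds new derivatives on the outside whereas [Ck] peels them from the inside;
    [rcons] reconciles the two orders. *)
Lemma Coo_iter_derive f :
  (forall vs p, U p -> differentiable (iter_derive f vs) p) -> Coo f.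
Proof.
move=> df k; elim: k f df => [|k IH] f df;
  (split; first by move=> p Up; exact: (df [::])) => // v.
apply: IH => vs p Up.
have -> : iter_derive ('D_v f) vs = iter_derive f (rcons vs v).
  by elim: vs {p Up} => //= w vs ->.
exact: df.
Qed.

Lemma Coo_differentiable f p : Coo f -> U p -> differentiable f p.
Proof. by move=> /(_ 0%N)[+ _]; apply. Qed.

Lemma Coo_derivable f p v : Coo f -> U p -> derivable f p v.
Proof. by move=> cf Up; apply/diff_derivable/Coo_differentiable. Qed.

Lemma Coo_derive f v : Coo f -> Coo ('D_v f).
Proof. by move=> cf k; have [_ /(_ v)] := cf k.+1. Qed.

Lemma CkS k f : Ck k.+1 f -> Ck k f.
Proof.
elim: k f => [|k IH] f [df cf]; first by split.
by split=> // v; apply: IH; exact: cf.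
Qed.

(** As [U] is open, derivatives at its points see only values on [U]. A derivative may therefore be
    replaced by a formula valid on [U] alone, as the closure lemmas below do. *)
Lemma eq_Ck k f g : (forall p, U p -> f p = g p) -> Ck k f -> Ck k g.
Proof.
elim: k f g => [|k IH] f g fg [df cf].
  split=> // p Up; apply: near_eq_differentiable (df _ Up).
  by apply: filterS (open_nbhs_nbhs (conj Uopen Up)) => q /fg.
split=> [p Up|v].
  apply: near_eq_differentiable (df _ Up).
  by apply: filterS (open_nbhs_nbhs (conj Uopen Up)) => q /fg.
apply: IH (cf v) => p Up; apply: near_eq_derive.
by apply: filterS (open_nbhs_nbhs (conj Uopen Up)) => q /fg.
Qed.

Lemma Ck_add k f g : Ck k f -> Ck k g -> Ck k (fun q => f q + g q).
Proof.
elim: k f g => [|k IH] f g [df cf] [dg cg];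
  (split; first by move=> p Up; exact: differentiableD (df _ Up) (dg _ Up)) => // v.
apply: (@eq_Ck _ (fun p => 'D_v f p + 'D_v g p)); last exact: IH (cf v) (cg v).
move=> p Up; apply/esym/derive_val; apply: is_derive_add.
  by apply/derivableP/diff_derivable/df.
by apply/derivableP/diff_derivable/dg.
Qed.

Lemma Ck_mul k f g : Ck k f -> Ck k g -> Ck k (fun q => f q * g q).
Proof.
elim: k f g => [|k IH] f g cf cg.
  split=> // p Up; apply: differentiableM; [exact: proj1 cf _ Up|exact: proj1 cg _ Up].
split=> [p Up|v]; first by apply: differentiableM; [exact: proj1 cf _ Up|exact: proj1 cg _ Up].
apply: (@eq_Ck _ (fun p => 'D_v f p * g p + f p * 'D_v g p)).
  move=> p Up; apply/esym/derive_val; apply: is_derive_mul.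
    by apply/derivableP/diff_derivable/(proj1 cf _ Up).
  by apply/derivableP/diff_derivable/(proj1 cg _ Up).
apply: Ck_add; apply: IH; [exact: proj2 cf v|exact: CkS|exact: CkS|exact: proj2 cg v].
Qed.

Lemma Ck_const k (c : R) : Ck k (fun=> c).
Proof.
elim: k c => [|k IH] c; split=> // v.
by apply: eq_Ck (IH 0) => p _; rewrite derive_val.
Qed.

Lemma Ck_inv k f : (forall p, U p -> f p != 0) -> Ck k f ->
  Ck k (fun q => (f q)^-1).
Proof.
move=> f0; elim: k => [|k IH] cf.
  by split=> // p Up; apply: differentiableV; [exact: proj1 cf _ Up|exact: f0].
split=> [p Up|v].
  by apply: differentiableV; [exact: proj1 cf _ Up|exact: f0].
(* The derivative is written through [(f p)^-1] itself, so that the induction hypothesis for the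
   inverse applies to it. *)
apply: (@eq_Ck _ (fun p => (-1 * ((f p)^-1 * (f p)^-1)) * 'D_v f p)).
  move=> p Up; rewrite mulN1r -invfM -expr2.
  apply/esym/derive_val; apply: is_derive_inv; first exact: f0.
  by apply/derivableP/diff_derivable/(proj1 cf _ Up).
have cV := IH (CkS cf).
by apply: Ck_mul; [apply: Ck_mul; [exact: Ck_const|exact: Ck_mul]|exact: proj2 cf v].
Qed.

Lemma eq_Coo f g : (forall p, U p -> f p = g p) -> Coo f -> Coo g.
Proof. by move=> fg cf k; apply: eq_Ck (cf k). Qed.

Lemma Coo_add f g : Coo f -> Coo g -> Coo (fun q => f q + g q).
Proof. by move=> cf cg k; apply: Ck_add. Qed.

Lemma Coo_mul f g : Coo f -> Coo g -> Coo (fun q => f q * g q).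
Proof. by move=> cf cg k; apply: Ck_mul. Qed.

Lemma Coo_const (c : R) : Coo (fun=> c).
Proof. by move=> k; exact: Ck_const. Qed.

Lemma Coo_inv f : (forall p, U p -> f p != 0) -> Coo f ->
  Coo (fun q => (f q)^-1).
Proof. by move=> f0 cf k; apply: Ck_inv. Qed.

Lemma Coo_linear (f : {linear V -> R}) : continuous f -> Coo f.
Proof.
move=> fc k.
have df p : differentiable f p by exact: linear_differentiable.
case: k => [|k]; split=> // v.
have -> : 'D_v f = fun=> f v by apply/funext => p; rewrite deriveE // diff_lin.
exact: Ck_const.
Qed.

Lemma Coo_opp f : Coo f -> Coo (fun q => - f q).
Proof.
move=> /(Coo_mul (Coo_const (-1))); apply: eq_Coo => p _.
by rewrite mulN1r.
Qed.

Lemma Coo_sqr f : Coo f -> Coo (fun q => f q ^+ 2).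
Proof.
move=> cf; apply: eq_Coo (Coo_mul cf cf) => p _.
by rewrite expr2.
Qed.

(** The mean value theorem is used twice: along [v] for the increment [g] of [f] by [h *: u], then
    along [u] for ['D_v f]. *)
Lemma second_difference f p u v (h : R) : 0 < h -> Coo f ->
  (forall s t, 0 <= s <= h -> 0 <= t <= h -> U (s *: u + (t *: v + p))) ->
  exists s t, [/\ 0 <= s <= h, 0 <= t <= h &
    f (h *: u + (h *: v + p)) - f (h *: v + p) - (f (h *: u + p) - f p)
    = 'D_u ('D_v f) (s *: u + (t *: v + p)) * h * h].
Proof.
move=> h0 cf Ust.
have hh : 0 <= h <= h by rewrite lexx ltW.
have h00 : 0 <= (0 : R) <= h by rewrite lexx ltW.
pose g q := f (h *: u + q) - f q.
have dg t : 0 <= t <= h ->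
    is_derive (t *: v + p) v g
      ('D_v f (h *: u + (t *: v + p)) - 'D_v f (t *: v + p)).
  move=> th; apply: is_derive_sub; last first.
    apply: derivableP; apply: Coo_derivable cf _.
    by have := Ust _ _ h00 th; rewrite scale0r add0r.
  have d1 : derivable f (h *: u + (t *: v + p)) v.
    by apply: Coo_derivable cf _; apply: Ust.
  have E : (fun k : R => k^-1 *: (f (h *: u + (k *: v + (t *: v + p)))
              - f (h *: u + (t *: v + p)))) =
           (fun k : R => k^-1 *: (f (k *: v + (h *: u + (t *: v + p)))
              - f (h *: u + (t *: v + p)))).
    by apply/funext => k; rewrite addrCA.
  by apply: DeriveDef; rewrite /derivable /derive /= E.
have [t th E] := @mean_value_line _ _ g p v h h0 (fun t th => (dg t th).(ex_derive)).
rewrite (dg t th).(derive_val) in E.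
have cDf : Coo ('D_v f) by exact: Coo_derive.
have [s sh E'] := @mean_value_line _ _ ('D_v f) (t *: v + p) u h h0
  (fun s sh => Coo_derivable cDf (Ust s t sh th)).
by exists s, t; split=> //; rewrite -E' -E.
Qed.

(* Two mean values in each order evaluate the same second difference, so the
   two mixed derivatives agree at points arbitrarily close to p. *)
Lemma derive_comm f p u v : Coo f -> U p ->
  'D_u ('D_v f) p = 'D_v ('D_u f) p.
Proof.
move=> cf Up.
have cont w w' : {for p, continuous ('D_w ('D_w' f))}.
  by apply/differentiable_continuous/Coo_differentiable => //; do 2 apply: Coo_derive.
apply/eqP; rewrite -subr_eq0 -normr_le0; apply/ler_addgt0Pr => e e0; rewrite add0r.
have e2 : 0 < e / 2 by rewrite divr_gt0.
have N1 : \forall q \near p, `|'D_u ('D_v f) p - 'D_u ('D_v f) q| < e / 2.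
  by have /cvgrPdist_lt := cont u v; apply.
have N2 : \forall q \near p, `|'D_v ('D_u f) p - 'D_v ('D_u f) q| < e / 2.
  by have /cvgrPdist_lt := cont v u; apply.
have NU : \forall q \near p, U q by exact: open_nbhs_nbhs.
have [d /= d0 Hd] : exists2 d : R, 0 < d & forall q, `|p - q| < d ->
    [/\ U q, `|'D_u ('D_v f) p - 'D_u ('D_v f) q| < e / 2 &
        `|'D_v ('D_u f) p - 'D_v ('D_u f) q| < e / 2].
  have /nbhs_normP[d d0 Hd] : \forall q \near p,
    [/\ U q, `|'D_u ('D_v f) p - 'D_u ('D_v f) q| < e / 2 &
        `|'D_v ('D_u f) p - 'D_v ('D_u f) q| < e / 2].
    by apply: filterS3 NU N1 N2 => q Uq A B; split.
  by exists d => // q; exact: Hd.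
(* With this side length both parallelograms stay within distance [d] of [p]; the summand 1 keeps
   the denominator positive when [u] and [v] vanish. *)
pose h := d / (`|u| + `|v| + 1).
have c0 : 0 < `|u| + `|v| + 1 by rewrite ltr_wpDl // addr_ge0.
have h0 : 0 < h by rewrite divr_gt0.
have small s t : 0 <= s <= h -> 0 <= t <= h -> `|p - (s *: u + (t *: v + p))| < d.
  move=> /andP[s0 sh] /andP[t0 th].
  rewrite distrC addrA addrK (le_lt_trans (ler_normD _ _)) // !normrZ !ger0_norm //.
  apply: (@le_lt_trans _ _ (h * `|u| + h * `|v|)); first by rewrite lerD // ler_wpM2r.
  rewrite -mulrDr /h mulrAC ltr_pdivrMr // ltr_pM2l //.
  by rewrite ltrDl.
have U1 s t : 0 <= s <= h -> 0 <= t <= h -> U (s *: u + (t *: v + p)).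
  by move=> sh th; have [] := Hd _ (small s t sh th).
have U2 s t : 0 <= s <= h -> 0 <= t <= h -> U (s *: v + (t *: u + p)).
  by move=> sh th; rewrite addrCA; apply: U1.
have [s [t [sh th E1]]] := second_difference h0 cf U1.
have [t' [s' [th' sh' E2]]] := second_difference h0 cf U2.
have hn0 : h != 0 by rewrite gt_eqF.
have E : 'D_u ('D_v f) (s *: u + (t *: v + p)) =
         'D_v ('D_u f) (t' *: v + (s' *: u + p)).
  apply: (mulIf hn0); apply: (mulIf hn0).
  apply: etrans (esym E1) _; apply: etrans _ E2.
  by rewrite [h *: v + (h *: u + p)]addrCA; ring.
have [_ A1 _] := Hd _ (small s t sh th).
have [_ _] := Hd _ (small s' t' sh' th'); rewrite addrCA -E => A2.
exact: ler_dist_split A1 A2.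
Qed.

End Smooth.

Lemma Coo_subset (R : realType) (V : normedModType R) (A B : set V) (f : V -> R) :
  A `<=` B -> Coo B f -> Coo A f.
Proof.
move=> AB cf k; move: f {cf}(cf k); elim: k => [|k IH] f [df cf].
  by split=> // p /AB; exact: df.
by split=> [p /AB|v]; [exact: df|exact: IH (cf v)].
Qed.

Lemma Coo_near_neq0 (R : realType) (V : normedModType R) (A : set V)
    (f : V -> R) p :
  Coo A f -> A p -> f p != 0 -> \forall q \near p, f q != 0.
Proof.
move=> cf Ap; apply: cvgr_neq0.
exact: differentiable_continuous (Coo_differentiable cf Ap).
Qed.

(** * The compatibility identity for functions of (r, s) *)

Section RadialCalculus.
Variables (R : realType) (U : set (R * R)).
Hypothesis Uopen : open U.
Implicit Types (f g : R -> R -> R).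

(** Read as directional derivatives on the plane, [dr] and [ds] inherit closure of [Coo] under
    derivation and the symmetry of mixed derivatives. *)
Lemma drE f r s : dr f r s = 'D_(1, 0) (fun p : R * R => f p.1 p.2) (r, s).
Proof.
have E : (fun h : R => h^-1 *: (f (h *: 1 + r) s - f r s)) =
    (fun h : R => h^-1 *: (f (h *: 1 + r) (h *: 0 + s) - f r s)).
  by apply/funext => h; rewrite [h *: 0]mulr0 add0r.
by rewrite /dr derive1E /derive /= E.
Qed.

Lemma dsE f r s : ds f r s = 'D_(0, 1) (fun p : R * R => f p.1 p.2) (r, s).
Proof.
have E : (fun h : R => h^-1 *: (f r (h *: 1 + s) - f r s)) =
    (fun h : R => h^-1 *: (f (h *: 0 + r) (h *: 1 + s) - f r s)).
  by apply/funext => h; rewrite [h *: 0]mulr0 add0r.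
by rewrite /ds derive1E /derive /= E.
Qed.

Definition smooth2 f := Coo U (fun p : R * R => f p.1 p.2).

Lemma smooth2_dr f : smooth2 f -> smooth2 (dr f).
Proof.
move=> /(@Coo_derive _ _ _ _ ((1, 0) : R * R)); congr (Coo U).
by apply/funext => -[r s]; rewrite drE.
Qed.

Lemma smooth2_ds f : smooth2 f -> smooth2 (ds f).
Proof.
move=> /(@Coo_derive _ _ _ _ ((0, 1) : R * R)); congr (Coo U).
by apply/funext => -[r s]; rewrite dsE.
Qed.

Lemma ds_dr f r s : smooth2 f -> U (r, s) -> ds (dr f) r s = dr (ds f) r s.
Proof.
move=> cf Urs; rewrite drE dsE.
have -> : (fun p : R * R => dr f p.1 p.2) = 'D_(1, 0) (fun p => f p.1 p.2).
  by apply/funext => -[? ?]; rewrite drE.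
have -> : (fun p : R * R => ds f p.1 p.2) = 'D_(0, 1) (fun p => f p.1 p.2).
  by apply/funext => -[? ?]; rewrite dsE.
exact: (derive_comm Uopen _ _ cf Urs).
Qed.

Lemma is_derive_comp_smooth2 (V : normedModType R) f (g h : V -> R) p v a b :
  smooth2 f -> U (g p, h p) -> is_derive p v g a -> is_derive p v h b ->
  is_derive p v (fun q => f (g q) (h q))
    (dr f (g p) (h p) * a + ds f (g p) (h p) * b).
Proof.
move=> cf Up ga hb; rewrite drE dsE.
exact: (is_derive_comp2 (Coo_differentiable cf Up) ga hb).
Qed.

Lemma is_derive_dr f r s : smooth2 f -> U (r, s) ->
  is_derive r 1 (f ^~ s) (dr f r s).
Proof.
move=> cf Urs.
have := is_derive_comp_smooth2 (g := id) (h := fun=> s) cf Urs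
  (is_derive_id r 1) (is_derive_const s r 1).
by rewrite mulr1 mulr0 addr0.
Qed.

Lemma is_derive_ds f r s : smooth2 f -> U (r, s) ->
  is_derive s 1 (f r) (ds f r s).
Proof.
move=> cf Urs.
have := is_derive_comp_smooth2 (g := fun=> r) (h := id) cf Urs
  (is_derive_const r s 1) (is_derive_id s 1).
by rewrite mulr1 mulr0 add0r.
Qed.

Lemma near_fst r s : U (r, s) -> \forall x \near r, U (x, s).
Proof.
move=> Urs; have /nbhs_ballP[e e0 He] : nbhs (r, s) U by exact: open_nbhs_nbhs.
apply/nbhs_ballP; exists e => // x xr; apply: He; split=> //=.
exact: ballxx.
Qed.

Lemma near_snd r s : U (r, s) -> \forall x \near s, U (r, x).
Proof.
move=> Urs; have /nbhs_ballP[e e0 He] : nbhs (r, s) U by exact: open_nbhs_nbhs.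
apply/nbhs_ballP; exists e => // x xr; apply: He; split=> //=.
exact: ballxx.
Qed.

(** This differentiates an identity valid on the open set [U]. Taking any [a] with an [is_derive]
    proof allows the derivative to be assembled term by term from the derivation rules. *)
Lemma is_derive_dr_eq0 f r s a : (forall r s, U (r, s) -> f r s = 0) ->
  U (r, s) -> is_derive r 1 (f ^~ s) a -> a = 0.
Proof.
move=> f0 Urs [_ <-].
rewrite (@near_eq_derive _ _ _ _ (fun=> 0)) ?derive_cst //.
by apply: filterS (near_fst Urs) => x /f0.
Qed.

Lemma is_derive_ds_eq0 f r s a : (forall r s, U (r, s) -> f r s = 0) ->
  U (r, s) -> is_derive s 1 (f r) a -> a = 0.
Proof.
move=> f0 Urs [_ <-].
rewrite (@near_eq_derive _ _ _ _ (fun=> 0)) ?derive_cst //.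
by apply: filterS (near_snd Urs) => x /f0.
Qed.

Lemma smooth2_fst : smooth2 (fun r _ => r).
Proof. by apply: (Coo_linear Uopen (f := fst)) => p; exact: cvg_fst. Qed.

Lemma smooth2_snd : smooth2 (fun _ s => s).
Proof. by apply: (Coo_linear Uopen (f := snd)) => p; exact: cvg_snd. Qed.

Lemma smooth2_const c : smooth2 (fun _ _ => c).
Proof. exact: (Coo_const Uopen). Qed.

Lemma smooth2_add f g : smooth2 f -> smooth2 g ->
  smooth2 (fun r s => f r s + g r s).
Proof. exact: (Coo_add Uopen). Qed.

Lemma smooth2_opp f : smooth2 f -> smooth2 (fun r s => - f r s).
Proof. exact: (Coo_opp Uopen). Qed.

Lemma smooth2_mul f g : smooth2 f -> smooth2 g ->
  smooth2 (fun r s => f r s * g r s).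
Proof. exact: (Coo_mul Uopen). Qed.

Lemma smooth2_sqr f : smooth2 f -> smooth2 (fun r s => f r s ^+ 2).
Proof. exact: (Coo_sqr Uopen). Qed.

Lemma smooth2_inv f : (forall r s, U (r, s) -> f r s != 0) -> smooth2 f ->
  smooth2 (fun r s => (f r s)^-1).
Proof. by move=> f0; apply: (Coo_inv Uopen) => -[r s]; exact: f0. Qed.

Ltac smooth2_step :=
  lazymatch goal with
  | H : smooth2 ?f |- smooth2 ?f => exact H
  | |- smooth2 (fun r s => r) => exact smooth2_fst
  | |- smooth2 (fun r s => s) => exact smooth2_snd
  | |- smooth2 (fun _ _ => ?c) => exact (smooth2_const c)
  | |- smooth2 (fun r s => @GRing.exp _ (@?f r s) 2) =>
      apply (@smooth2_sqr f)
  | |- smooth2 (fun r s => @GRing.add _ (@?f r s) (@?g r s)) =>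
      apply (@smooth2_add f g)
  | |- smooth2 (fun r s => @GRing.opp _ (@?f r s)) => apply (@smooth2_opp f)
  | |- smooth2 (fun r s => @GRing.mul _ (@?f r s) (@?g r s)) =>
      apply (@smooth2_mul f g)
  | |- smooth2 (fun r s => dr ?f r s) => apply (@smooth2_dr f)
  | |- smooth2 (fun r s => ds ?f r s) => apply (@smooth2_ds f)
  | |- smooth2 (fun r s => ?f r s) => progress change (smooth2 f)
  | |- smooth2 (dr ?f) => apply (@smooth2_dr f)
  | |- smooth2 (ds ?f) => apply (@smooth2_ds f)
  end.

Variable phi : R -> R -> R.

Let P := Defs.Pfun phi.
Let Q := Defs.Qfun phi.

Hypothesis phi_smooth : smooth2 phi.
Hypothesis r_neq0 : forall r s, U (r, s) -> r != 0.
Hypothesis phi_neq0 : forall r s, U (r, s) -> phi r s != 0.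

(** This is x^i F_{y^i} in the variables (r, s); see [sum_x_F_y]. *)
Definition Wfun phi (r s : R) : R := s * phi r s + (r ^+ 2 - s ^+ 2) * ds phi r s.

(** The common denominator of P and Q, which is also the s-derivative of [Wfun]. *)
Definition Dfun phi (r s : R) : R :=
  phi r s - s * ds phi r s + (r ^+ 2 - s ^+ 2) * ds (ds phi) r s.

Hypothesis D_neq0 : forall r s, U (r, s) -> Dfun phi r s != 0.

Lemma smooth2_D : smooth2 (Dfun phi).
Proof.
change (smooth2 (fun r s =>
  phi r s - s * ds phi r s + (r ^+ 2 - s ^+ 2) * ds (ds phi) r s)).
by repeat smooth2_step.
Qed.

Lemma smooth2_W : smooth2 (Wfun phi).
Proof.
change (smooth2 (fun r s => s * phi r s + (r ^+ 2 - s ^+ 2) * ds phi r s)).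
by repeat smooth2_step.
Qed.

Lemma smooth2_Q : smooth2 Q.
Proof.
change (smooth2 (fun r s => (2 * r)^-1 *
  ((- dr phi r s + s * ds (dr phi) r s + r * ds (ds phi) r s) / Dfun phi r s))).
apply smooth2_mul.
  apply smooth2_inv; last by repeat smooth2_step.
  by move=> r s /r_neq0 r0; rewrite mulf_neq0 // pnatr_eq0.
apply smooth2_mul; first by repeat smooth2_step.
by apply smooth2_inv; [exact: D_neq0|exact: smooth2_D].
Qed.

Lemma smooth2_P : smooth2 P.
Proof.
have cQ := smooth2_Q; have cW := smooth2_W.
change (smooth2 (fun r s => - (Q r s / phi r s) * Wfun phi r s +
  (2 * r * phi r s)^-1 * (s * dr phi r s + r * ds phi r s))).
have ci : smooth2 (fun r s => (phi r s)^-1).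
  by apply smooth2_inv => //; exact: phi_neq0.
have ci2 : smooth2 (fun r s => (2 * r * phi r s)^-1).
  apply smooth2_inv; last by repeat smooth2_step.
  by move=> r s Urs; rewrite !mulf_neq0 ?pnatr_eq0 ?(r_neq0 Urs) ?(phi_neq0 Urs).
by repeat smooth2_step.
Qed.

(* Contracting F_{x^j} = G^i_j F_{y^i} with y^j gives this equation; the
   coefficient of x_j gives [radial_horizontal] below. *)
Lemma radial_spray r s : U (r, s) ->
  ds phi r s + s / r * dr phi r s - 2 * P r s * phi r s
  - 2 * Q r s * Wfun phi r s = 0.
Proof.
move=> Urs; rewrite /P /Defs.Pfun -/(Q r s) /Wfun; field.
by rewrite (phi_neq0 Urs) (r_neq0 Urs).
Qed.

Lemma Q_mulD r s : U (r, s) ->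
  2 * Q r s * Dfun phi r s
  = ds (ds phi) r s - dr phi r s / r + s / r * ds (dr phi) r s.
Proof.
move=> Urs; have := D_neq0 Urs; have := r_neq0 Urs.
rewrite /Q /Defs.Qfun -/(Dfun phi r s).
move: (Dfun phi r s) (dr phi r s) (ds (dr phi) r s) (ds (ds phi) r s).
by move=> D a b c r0 D0; field; rewrite D0 r0.
Qed.

(** Differentiating [radial_spray] in s produces the term [2 * Q r s * Dfun phi r s], since [Dfun]
    is the s-derivative of [Wfun]. Replacing it by [Q_mulD] cancels the second derivatives of phi
    and leaves twice the equation. *)
Lemma radial_horizontal r s : U (r, s) ->
  dr phi r s / r - (P r s * ds phi r s + ds P r s * phi r s)
  - Wfun phi r s * ds Q r s = 0.
Proof.
move=> Urs.
have cP := smooth2_P; have cQ := smooth2_Q; have cW := smooth2_W.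
have cr := smooth2_dr phi_smooth; have cs := smooth2_ds phi_smooth.
have dss := is_derive_ds cs Urs.
have dsr := is_derive_ds cr Urs.
have dsP := is_derive_ds cP Urs.
have dsQ := is_derive_ds cQ Urs.
have dsf := is_derive_ds phi_smooth Urs.
have di := is_derive_id s (1 : R).
have dc c := is_derive_const c s (1 : R).
have dW : is_derive s 1 (Wfun phi r) (Dfun phi r s).
  apply: (is_derive_eq (is_derive_add (is_derive_mul di dsf)
    (is_derive_mul (is_derive_sub (dc (r ^+ 2)) (is_derive_sqr di)) dss))).
  by rewrite /Dfun; ring.
have E := is_derive_ds_eq0 radial_spray Urs
  (is_derive_sub (is_derive_sub (is_derive_add dss
    (is_derive_mul (is_derive_mul di (dc r^-1)) dsr))
    (is_derive_mul (is_derive_mul (dc 2) dsP) dsf))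
    (is_derive_mul (is_derive_mul (dc 2) dsQ) dW)).
have r0 := r_neq0 Urs; have two0 : (2 : R) != 0 by rewrite pnatr_eq0.
apply: (mulfI two0); rewrite mulr0 -E; have := Q_mulD Urs.
move: (Wfun _ _ _) (Dfun _ _ _) (ds (dr phi) r s) (ds (ds phi) r s)
  (dr phi r s) (ds phi r s) (phi r s) (ds P r s) (P r s) (ds Q r s) (Q r s).
by move=> W D frs fss fr fs f ps p qs q ->; ring.
Qed.

(* The last three hypotheses are the r-derivative of the equation (E2) of
   [radial_spray] and the r- and s-derivatives of the equation (E1) of
   [radial_horizontal].  The combination
   - (1/r) dr E2 + (s/r) dr E1 + (1 - 2 (r^2 - s^2) Q) ds E1
   reproduces all derivatives of order two of P and Q in the conclusion; what
   remains has order one and is a combination of E1, E2 and the definition of Q. *)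
Lemma compat_identity (K : fieldType)
    (r s f fr fs frr frs fss p pr ps prs pss q qr qs qrs qss : K) :
  let a := r ^+ 2 - s ^+ 2 in
  let W := s * f + a * fs in
  let D := f - s * fs + a * fss in
  r != 0 ->
  2 * q * D = fss - fr / r + s / r * frs ->
  fs + s / r * fr - 2 * p * f - 2 * q * W = 0 ->
  fr / r - (p * fs + ps * f) - W * qs = 0 ->
  frs + (- (s / r ^+ 2) * fr + s / r * frr) - 2 * (pr * f + p * fr)
    - 2 * (qr * W + q * (s * fr + 2 * r * fs + a * frs)) = 0 ->
  frr / r - fr / r ^+ 2 - (pr * fs + p * frs + prs * f + ps * fr)
    - ((s * fr + 2 * r * fs + a * frs) * qs + W * qrs) = 0 ->
  frs / r - (ps * fs + p * fss + pss * f + ps * fs) - (D * qs + W * qss) = 0 ->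
  fs * (2 * q - s / r * pr - ps + 2 * a * ps * q + p ^+ 2 + 2 * s * p * q)
  + W * (2 / r * qr - qss - s / r * qrs + 2 * a * q * qss + 4 * q ^+ 2
         - a * qs ^+ 2 - 2 * s * q * qs)
  + f * (2 / r * pr - s / r * prs - pss - qs + 2 * p * q - 2 * s * ps * q
         + 2 * a * pss * q - p * ps - s * p * qs - a * ps * qs) = 0.
Proof.
move=> a W D r0 QD E2 E1 E2r E1r E1s.
(* For u = 1 the spray moves r at rate [s / r] and s at rate [1 - 2 * a * q], so the second and
   third summands form the spray derivative of E1. The first is the x_j part of the x^j-derivative
   of E2. *)
rewrite [LHS](_ : _ =
  - r^-1 * (frs + (- (s / r ^+ 2) * fr + s / r * frr) - 2 * (pr * f + p * fr)
    - 2 * (qr * W + q * (s * fr + 2 * r * fs + a * frs)))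
  + s / r * (frr / r - fr / r ^+ 2 - (pr * fs + p * frs + prs * f + ps * fr)
    - ((s * fr + 2 * r * fs + a * frs) * qs + W * qrs))
  + (1 - 2 * a * q) * (frs / r - (ps * fs + p * fss + pss * f + ps * fs)
    - (D * qs + W * qss))
  - (p + a * qs) * (2 * q * D - (fss - fr / r + s / r * frs))
  + (a * qs - p) * (fr / r - (p * fs + ps * f) - W * qs)
  + (ps + s * qs - 2 * q) * (fs + s / r * fr - 2 * p * f - 2 * q * W)).
  by rewrite QD E2 E1 E2r E1r E1s subrr !mulr0 !addr0 subr0.
by rewrite /D /W /a; field.
Qed.

Ltac generalize_jets r s :=
  repeat match goal with
  | |- context [dr ?f r s] => generalize (dr f r s); intro
  | |- context [ds ?f r s] => generalize (ds f r s); intro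
  end;
  generalize (P r s) (Q r s) (phi r s); intros ? ? ?.

(** The jets of phi, P and Q are inserted into [compat_identity]. Its three differentiated
    hypotheses come from equations that hold on all of the open set [U]; [ds_dr] brings every mixed
    derivative to the single form used there. *)
Lemma radial_compatibility r s : U (r, s) ->
  ds phi r s * R1fun phi r s
  + (s * phi r s + (r ^+ 2 - s ^+ 2) * ds phi r s) * R3fun phi r s
  + phi r s * R5fun phi r s = 0.
Proof.
move=> Urs; have r0 := r_neq0 Urs.
have cf := phi_smooth; have cP := smooth2_P; have cQ := smooth2_Q.
have cr := smooth2_dr cf; have cs := smooth2_ds cf.
have cPs := smooth2_ds cP; have cQs := smooth2_ds cQ.
have cW := smooth2_W.
have dir := is_derive_id r (1 : R); have dis := is_derive_id s (1 : R).
have kr c := is_derive_const c r (1 : R).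
have ks c := is_derive_const c s (1 : R).
have rV := is_derive_inv r0 dir.
have Wr : is_derive r 1 (fun x => Wfun phi x s)
    (s * dr phi r s + 2 * r * ds phi r s + (r ^+ 2 - s ^+ 2) * ds (dr phi) r s).
  apply: (is_derive_eq (is_derive_add (is_derive_mul (kr s) (is_derive_dr cf Urs))
    (is_derive_mul (is_derive_sub (is_derive_sqr dir) (kr (s ^+ 2)))
       (is_derive_dr cs Urs)))).
  by rewrite (ds_dr cf Urs) /=; generalize_jets r s; ring.
have Ws : is_derive s 1 (Wfun phi r) (Dfun phi r s).
  apply: (is_derive_eq (is_derive_add (is_derive_mul dis (is_derive_ds cf Urs))
    (is_derive_mul (is_derive_sub (ks (r ^+ 2)) (is_derive_sqr dis))
       (is_derive_ds cs Urs)))).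
  by rewrite /Dfun; ring.
apply: (compat_identity (frr := dr (dr phi) r s) (frs := ds (dr phi) r s)
  (pr := dr P r s) (prs := ds (dr P) r s) (pss := ds (ds P) r s)
  (qr := dr Q r s) (qrs := ds (dr Q) r s) (qss := ds (ds Q) r s) r0
  (Q_mulD Urs) (radial_spray Urs) (radial_horizontal Urs)).
- apply: (is_derive_dr_eq0 radial_spray Urs).
  apply: (is_derive_eq (is_derive_sub (is_derive_sub
    (is_derive_add (is_derive_dr cs Urs)
      (is_derive_mul (is_derive_mul (kr s) rV) (is_derive_dr cr Urs)))
    (is_derive_mul (is_derive_mul (kr 2) (is_derive_dr cP Urs)) (is_derive_dr cf Urs)))
    (is_derive_mul (is_derive_mul (kr 2) (is_derive_dr cQ Urs)) Wr))).
  by rewrite (ds_dr cf Urs) /Wfun; generalize_jets r s; ring.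
- apply: (is_derive_dr_eq0 radial_horizontal Urs).
  apply: (is_derive_eq (is_derive_sub (is_derive_sub
    (is_derive_mul (is_derive_dr cr Urs) rV)
    (is_derive_add
      (is_derive_mul (is_derive_dr cP Urs) (is_derive_dr cs Urs))
      (is_derive_mul (is_derive_dr cPs Urs) (is_derive_dr cf Urs))))
    (is_derive_mul Wr (is_derive_dr cQs Urs)))).
  by rewrite (ds_dr cf Urs) (ds_dr cP Urs) (ds_dr cQ Urs) /Wfun; generalize_jets r s; ring.
- apply: (is_derive_ds_eq0 radial_horizontal Urs).
  apply: (is_derive_eq (is_derive_sub (is_derive_sub
    (is_derive_mul (is_derive_ds cr Urs) (ks r^-1))
    (is_derive_add
      (is_derive_mul (is_derive_ds cP Urs) (is_derive_ds cs Urs))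
      (is_derive_mul (is_derive_ds cPs Urs) (is_derive_ds cf Urs))))
    (is_derive_mul Ws (is_derive_ds cQs Urs)))).
  by rewrite /Wfun /Dfun; generalize_jets r s; ring.
Qed.

End RadialCalculus.

(** * Curvature of a spray along which F is parallel *)

(** Here [N i k] stands for G^i_k, [Nj i] for G^i_j, [Nx k i] and [Ny k i] for the x^k- and
    y^k-derivatives of G^i_j, and [gx] for the x^j-derivative of G. The first three hypotheses are
    the parallelism of F and its derivatives, the last two the geodesic equation differentiated in
    x^j and y^i. Parallelism trades derivatives of G^i_j for second derivatives of F, which the
    geodesic equation cancels. *)
Lemma curvature_algebra (K : comNzRingType) (n : nat)
    (y g gx fx fy Nj Fxj Fyj : 'I_n -> K)
    (N Nx Ny Fxy Fyy : 'I_n -> 'I_n -> K) :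
  (forall k, fx k = \sum_i N i k * fy i) ->
  (forall k, Fxj k = \sum_i (Nx k i * fy i + Nj i * Fxy k i)) ->
  (forall k, Fyj k = \sum_i (Ny k i * fy i + Nj i * Fyy k i)) ->
  \sum_k y k * Fxj k = 2 * \sum_k (gx k * fy k + g k * Fyj k) ->
  (forall i, fx i + \sum_k y k * Fxy k i
             = 2 * \sum_k (N k i * fy k + g k * Fyy k i)) ->
  \sum_i (2 * gx i - (\sum_k y k * Nx k i - 2 * \sum_k g k * Ny k i)
          - \sum_k N i k * Nj k) * fy i = 0.
Proof.
move=> fxE FxjE FyjE geod_x geod_y.
have double (a : 'I_n -> K) (M : 'I_n -> 'I_n -> K) :
    \sum_i (\sum_k a k * M k i) * fy i = \sum_k a k * \sum_i M k i * fy i.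
  under eq_bigr do rewrite mulr_suml.
  rewrite exchange_big /=; apply: eq_bigr => k _.
  by rewrite mulr_sumr; apply: eq_bigr => i _; rewrite mulrA.
have swap (a : 'I_n -> K) (M : 'I_n -> 'I_n -> K) :
    \sum_k a k * \sum_i Nj i * M k i = \sum_i Nj i * \sum_k a k * M k i.
  under eq_bigr do rewrite mulr_sumr.
  rewrite exchange_big /=; apply: eq_bigr => k _.
  by rewrite mulr_sumr; apply: eq_bigr => i _; rewrite mulrCA.
have -> : \sum_i (2 * gx i - (\sum_k y k * Nx k i - 2 * \sum_k g k * Ny k i)
          - \sum_k N i k * Nj k) * fy i =
    2 * \sum_i gx i * fy i - \sum_i (\sum_k y k * Nx k i) * fy i
    + 2 * \sum_i (\sum_k g k * Ny k i) * fy i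
    - \sum_i (\sum_k Nj k * N i k) * fy i.
  rewrite !mulr_sumr -!sumrN -!big_split /=; apply: eq_bigr => i _.
  under [X in _ - X]eq_bigr do rewrite mulrC.
  by ring.
rewrite !double.
have -> : \sum_k y k * (\sum_i Nx k i * fy i) =
    \sum_k y k * Fxj k - \sum_i Nj i * \sum_k y k * Fxy k i.
  rewrite -swap -sumrB; apply: eq_bigr => k _.
  by rewrite FxjE big_split /= mulrDr addrK.
have -> : \sum_k g k * (\sum_i Ny k i * fy i) =
    \sum_k g k * Fyj k - \sum_i Nj i * \sum_k g k * Fyy k i.
  rewrite -swap -sumrB; apply: eq_bigr => k _.
  by rewrite FyjE big_split /= mulrDr addrK.
rewrite geod_x big_split /=.
(* The x^j-derivatives have cancelled. What is left is the y^i-derivative of the geodesic equation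
   contracted with [Nj], in which the sum of [N k i * fy k] is again [fx i]. *)
suff : \sum_i Nj i * (\sum_k y k * Fxy k i) =
    2 * \sum_i Nj i * (\sum_k g k * Fyy k i) + \sum_i Nj i * fx i.
  move=> ->; under [X in _ - X]eq_bigr do rewrite -fxE; ring.
rewrite mulr_sumr -big_split /=; apply: eq_bigr => i _.
have := geod_y i; rewrite big_split /= -fxE => /(canRL (addKr _)) ->; ring.
Qed.

Section TangentBundle.
Variables (R : realType) (n : nat).
Local Notation V := ('rV[R]_n * 'rV[R]_n)%type.

(** Coordinate directions in the product space make both kinds of partial derivative directional
    derivatives of one function, so that [derive_comm] covers the mixed ones. *)
Definition dirx (j : 'I_n) : V := (delta_mx 0 j, 0).

Definition diry (j : 'I_n) : V := (0, delta_mx 0 j).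

Lemma partial_xE j (f : 'rV[R]_n -> 'rV[R]_n -> R) x y :
  partial_x j f x y = 'D_(dirx j) (fun q : V => f q.1 q.2) (x, y).
Proof.
rewrite /partial_x /derive /=.
set f1 := fun h : R => _; set f2 := fun h : R => _.
suff -> : f1 = f2 by [].
by apply/funext => h; rewrite /f1 /f2 scaler0 add0r.
Qed.

Lemma partial_yE j (f : 'rV[R]_n -> 'rV[R]_n -> R) x y :
  partial_y j f x y = 'D_(diry j) (fun q : V => f q.1 q.2) (x, y).
Proof.
rewrite /partial_y /derive /=.
set f1 := fun h : R => _; set f2 := fun h : R => _.
suff -> : f1 = f2 by [].
by apply/funext => h; rewrite /f1 /f2 scaler0 add0r.
Qed.

Lemma is_derive_fiber_coord k (q v : V) :
  is_derive q v (fun q : V => q.2 0 k) (v.2 0 k).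
Proof.
apply/is_derive_lineP.
have -> : (fun t : R => (t *: v + q).2 0 k) =
    (fun t => t * v.2 0 k + q.2 0 k) by apply/funext => t; rewrite !mxE.
have := is_derive_add (is_derive_mul (is_derive_id (0 : R) (1 : R))
  (is_derive_const (v.2 0 k) (0 : R) (1 : R)))
  (is_derive_const (q.2 0 k) (0 : R) (1 : R)).
by rewrite mul1r mulr0 !addr0.
Qed.

Variables (T : set V) (F : V -> R) (G : 'I_n -> V -> R).
Hypothesis Topen : open T.
Hypothesis F_smooth : Coo T F.
Hypothesis G_derivable : forall i q v, T q -> derivable (G i) q v.
Hypothesis N_derivable : forall i j q v, T q ->
  derivable ('D_(diry j) (G i)) q v.
Hypothesis F_parallel : forall j q, T q ->
  'D_(dirx j) F q = \sum_(i < n) 'D_(diry j) (G i) q * 'D_(diry i) F q.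
Hypothesis F_geodesic : forall q, T q ->
  \sum_(k < n) q.2 0 k * 'D_(dirx k) F q =
  2 * \sum_(i < n) G i q * 'D_(diry i) F q.

Lemma is_derive_near_eq (f g : V -> R) q v a b :
  (forall q, T q -> f q = g q) -> T q ->
  is_derive q v f a -> is_derive q v g b -> a = b.
Proof.
move=> fg Tq [_ <-] [_ <-]; apply: near_eq_derive.
by apply: filterS (open_nbhs_nbhs (conj Topen Tq)) => p /fg.
Qed.

(* Differentiate [F_geodesic] along x^j and y^i and [F_parallel] along the
   spray: once mixed derivatives of F are commuted, every second derivative of
   F cancels. *)
Lemma curvature_annihilates p j : T p ->
  \sum_(i < n) (2 * 'D_(dirx j) (G i) p
    - (\sum_(k < n) p.2 0 k * 'D_(dirx k) ('D_(diry j) (G i)) p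
       - 2 * \sum_(k < n) G k p * 'D_(diry k) ('D_(diry j) (G i)) p)
    - \sum_(k < n) 'D_(diry k) (G i) p * 'D_(diry j) (G k) p)
    * 'D_(diry i) F p = 0.
Proof.
move=> Tp.
pose H w w' := 'D_w ('D_w' F) p.
have dF w w' : is_derive p w ('D_w' F) (H w w').
  by apply: derivableP; apply: (Coo_derivable (Coo_derive w' F_smooth) Tp).
have dG i w := derivableP (@G_derivable i p w Tp).
have dN i k w := derivableP (@N_derivable i k p w Tp).
have A (w : V) k : H w (dirx k) =
    \sum_(i < n) ('D_w ('D_(diry k) (G i)) p * 'D_(diry i) F p
                  + 'D_(diry k) (G i) p * H w (diry i)).
  apply: (is_derive_near_eq (F_parallel k) Tp (dF w (dirx k))).
  by apply: is_derive_bigsum => i; exact: is_derive_mul (dN i k w) (dF w (diry i)).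
have B (w : V) : \sum_(k < n) (w.2 0 k * 'D_(dirx k) F p
                         + p.2 0 k * H w (dirx k)) =
    2 * \sum_(i < n) ('D_w (G i) p * 'D_(diry i) F p + G i p * H w (diry i)).
  apply: (is_derive_near_eq F_geodesic Tp).
    apply: is_derive_bigsum => k.
    exact: is_derive_mul (is_derive_fiber_coord k p w) (dF w (dirx k)).
  apply: (is_derive_eq (is_derive_mul (is_derive_const (2 : R) p w)
    (is_derive_bigsum (fun i => is_derive_mul (dG i w) (dF w (diry i)))))).
  by rewrite mul0r add0r.
have comm w w' : H w w' = H w' w by exact: (derive_comm Topen _ _ F_smooth Tp).
have geod_x : \sum_k p.2 0 k * H (dirx k) (dirx j) =
    2 * \sum_k ('D_(dirx j) (G k) p * 'D_(diry k) F p
                + G k p * H (diry k) (dirx j)).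
  move: comm (B (dirx j)); clearbody H => comm.
  under eq_bigr => k _ do rewrite mxE mul0r add0r comm.
  by move=> ->; under eq_bigr => k _ do rewrite comm.
have geod_y i : 'D_(dirx i) F p + \sum_k p.2 0 k * H (dirx k) (diry i) =
    2 * \sum_k ('D_(diry i) (G k) p * 'D_(diry k) F p
                + G k p * H (diry k) (diry i)).
  move: comm (B (diry i)); clearbody H => comm.
  under [in RHS]eq_bigr => k _ do rewrite comm.
  move=> <-; rewrite big_split /=; congr (_ + _).
    rewrite (bigD1 i) //= mxE !eqxx mul1r big1 ?addr0 // => k /negbTE ki.
    by rewrite mxE eqxx ki mul0r.
  by apply: eq_bigr => k _; rewrite comm.
exact: curvature_algebra (fun k => F_parallel k Tp) (fun k => A (dirx k) j)
  (fun k => A (diry k) j) geod_x geod_y.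
Qed.

End TangentBundle.

(** * The variables r, u, s on the slit tangent bundle *)

Section EuclideanBundle.
Variables (R : realType) (n : nat).
Implicit Types (x y z : 'rV[R]_n).
Local Notation V := ('rV[R]_n * 'rV[R]_n)%type.
Implicit Types (q v : V).

Lemma dotC x y : dot x y = dot y x.
Proof. by apply: eq_bigr => i _; rewrite mulrC. Qed.

Lemma dotDl x y z : dot (x + y) z = dot x z + dot y z.
Proof. by rewrite /dot -big_split; apply: eq_bigr => i _; rewrite mxE mulrDl. Qed.

Lemma dotZl a x y : dot (a *: x) y = a * dot x y.
Proof. by rewrite /dot mulr_sumr; apply: eq_bigr => i _; rewrite mxE mulrA. Qed.

Lemma dot0l x : dot 0 x = 0.
Proof. by apply: big1 => i _; rewrite mxE mul0r. Qed.

Lemma dot_delta j x : dot (delta_mx 0 j) x = x 0 j.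
Proof.
rewrite /dot (bigD1 j) //= mxE !eqxx mul1r big1 ?addr0 // => k /negbTE kj.
by rewrite mxE kj andbF mul0r.
Qed.

Lemma dot_ge0 x : 0 <= dot x x.
Proof. by apply: sumr_ge0 => i _; rewrite -expr2 sqr_ge0. Qed.

Lemma sqr_enorm x : enorm x ^+ 2 = dot x x.
Proof. by rewrite sqr_sqrtr // dot_ge0. Qed.

Lemma enorm_gt0 x : (0 < enorm x) = (x != 0).
Proof.
rewrite sqrtr_gt0 lt_def dot_ge0 andbT; congr (~~ _).
apply/eqP/eqP => [x0|->]; last exact: dot0l.
apply/rowP => i; rewrite mxE; apply/eqP; rewrite -sqrf_eq0 expr2; apply/eqP.
move: x0 => /eqP; rewrite psumr_eq0 => [/allP/(_ i)|k _]; last first.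
  by rewrite -expr2 sqr_ge0.
by rewrite mem_index_enum => /(_ isT) /eqP.
Qed.

Lemma dot_svar x y : y != 0 -> dot x y = svar x y * enorm y.
Proof. by rewrite -enorm_gt0 => y0; rewrite /svar divfK // gt_eqF. Qed.

(** Cauchy-Schwarz: the squared length of x minus its projection on y is r^2 - s^2. Hence points of
    the bundle always land in the cone where phi is controlled. *)
Lemma normr_svar_le x y : y != 0 -> `|svar x y| <= enorm x.
Proof.
move=> y0; have u0 : 0 < enorm y by rewrite enorm_gt0.
rewrite -(@ler_pXn2r _ 2) // ?nnegrE ?sqrtr_ge0 // real_normK ?num_real //.
have := dot_ge0 (x + (- (svar x y / enorm y)) *: y).
rewrite dotDl dotZl ![dot _ (_ + _)]dotC !dotDl !dotZl [dot y x]dotC.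
rewrite -!sqr_enorm (dot_svar x y0) -subr_ge0; congr (0 <= _).
by field; rewrite gt_eqF.
Qed.

Lemma is_derive_coordx k q v : is_derive q v (fun q => q.1 0 k) (v.1 0 k).
Proof.
apply/is_derive_lineP.
have -> : (fun t : R => (t *: v + q).1 0 k) =
    (fun t => t * v.1 0 k + q.1 0 k) by apply/funext => t; rewrite !mxE.
have := is_derive_add (is_derive_mul (is_derive_id (0 : R) (1 : R))
  (is_derive_const (v.1 0 k) (0 : R) (1 : R)))
  (is_derive_const (q.1 0 k) (0 : R) (1 : R)).
by rewrite mul1r mulr0 !addr0.
Qed.

Lemma is_derive_dot (f g : 'I_n -> V -> R) (a b : 'I_n -> R) q v :
  (forall i, is_derive q v (f i) (a i)) -> (forall i, is_derive q v (g i) (b i)) ->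
  is_derive q v (fun q => \sum_i f i q * g i q)
    (\sum_i (a i * g i q + f i q * b i)).
Proof. by move=> fa gb; apply: is_derive_bigsum => i; exact: is_derive_mul. Qed.

Lemma is_derive_dotxy q v :
  is_derive q v (fun q => dot q.1 q.2) (dot v.1 q.2 + dot q.1 v.2).
Proof.
apply: (is_derive_eq (is_derive_dot (fun i => is_derive_coordx i q v)
  (fun i => is_derive_fiber_coord i q v))).
by rewrite big_split.
Qed.

Lemma is_derive_enormx q v : q.1 != 0 ->
  is_derive q v (fun q => enorm q.1) (dot v.1 q.1 / enorm q.1).
Proof.
rewrite -enorm_gt0 => x0; have d0 : 0 < dot q.1 q.1 by rewrite -sqrtr_gt0.
have dd : is_derive q v (fun q => dot q.1 q.1) (2 * dot v.1 q.1).
  apply: (is_derive_eq (is_derive_dot (fun i => is_derive_coordx i q v)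
    (fun i => is_derive_coordx i q v))).
  by rewrite big_split /= -/(dot _ _) -/(dot _ _) (dotC q.1); ring.
apply: (is_derive_eq (is_derive_comp (f := fun q : V => dot q.1 q.1)
  (is_derive1_sqrt d0) dd)).
by rewrite -/(enorm _); field; rewrite gt_eqF.
Qed.

Lemma is_derive_enormy q v : q.2 != 0 ->
  is_derive q v (fun q => enorm q.2) (dot v.2 q.2 / enorm q.2).
Proof.
rewrite -enorm_gt0 => y0; have d0 : 0 < dot q.2 q.2 by rewrite -sqrtr_gt0.
have dd : is_derive q v (fun q => dot q.2 q.2) (2 * dot v.2 q.2).
  apply: (is_derive_eq (is_derive_dot (fun i => is_derive_fiber_coord i q v)
    (fun i => is_derive_fiber_coord i q v))).
  by rewrite big_split /= -/(dot _ _) -/(dot _ _) (dotC q.2); ring.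
apply: (is_derive_eq (is_derive_comp (f := fun q : V => dot q.2 q.2)
  (is_derive1_sqrt d0) dd)).
by rewrite -/(enorm _); field; rewrite gt_eqF.
Qed.

Lemma is_derive_svar q v : q.2 != 0 ->
  is_derive q v (fun q => svar q.1 q.2)
    ((dot v.1 q.2 + dot v.2 q.1) / enorm q.2
     - svar q.1 q.2 * dot v.2 q.2 / enorm q.2 ^+ 2).
Proof.
move=> y0; have u0 : enorm q.2 != 0 by rewrite gt_eqF // enorm_gt0.
apply: (is_derive_eq (is_derive_mul (is_derive_dotxy q v)
  (is_derive_inv (f := fun q : V => enorm q.2) u0 (is_derive_enormy v y0)))).
by rewrite (dotC q.1 v.2) (dot_svar q.1 y0); field.
Qed.

Lemma enorm_continuous : continuous (@enorm R n).
Proof.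
move=> x; apply: (@continuous_comp _ _ _ (fun x => dot x x) Num.sqrt);
  last exact: sqrt_continuous.
rewrite /dot; apply: continuous_big => [|i _ z].
  exact: add_continuous.
have c := @coord_continuous R 1 n 0 i z; exact: (cvgM c c).
Qed.

(** The points with x = 0 are removed as well, because |x| is not differentiable there and P and Q
    carry a factor 1/r. *)
Definition slit_ball (r0 : R) : set V :=
  [set q | [/\ q.1 != 0, enorm q.1 < r0 & q.2 != 0]].

Lemma open_slit_ball r0 : open (slit_ball r0).
Proof.
have -> : slit_ball r0 = [set q | 0 < enorm q.1] `&` [set q | enorm q.1 < r0]
    `&` [set q | 0 < enorm q.2].
  apply/seteqP; split=> q; rewrite /slit_ball /= !enorm_gt0; first by case.
  by case=> -[].
have c1 : continuous (fun q : V => enorm q.1).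
  move=> q; apply: (@continuous_comp _ _ _ fst (@enorm R n)); first exact: cvg_fst.
  exact: enorm_continuous.
have c2 : continuous (fun q : V => enorm q.2).
  move=> q; apply: (@continuous_comp _ _ _ snd (@enorm R n)); first exact: cvg_snd.
  exact: enorm_continuous.
apply: openI; first apply: openI.
- apply: (@open_comp _ _ (fun q : V => enorm q.1) [set x | 0 < x]).
    by move=> q _; exact: c1.
  exact: open_gt.
- apply: (@open_comp _ _ (fun q : V => enorm q.1) [set x | x < r0]).
    by move=> q _; exact: c1.
  exact: open_lt.
- apply: (@open_comp _ _ (fun q : V => enorm q.2) [set x | 0 < x]).
    by move=> q _; exact: c2.
  exact: open_gt.
Qed.

End EuclideanBundle.

(** * Spherically symmetric metrics *)

Section SphericalMetric.
Variables (R : realType) (n : nat).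
Local Notation V := ('rV[R]_n * 'rV[R]_n)%type.
Implicit Types (q v : V) (f g : R -> R -> R).

Definition radial f : V -> R := fun q => f (enorm q.1) (svar q.1 q.2).

(** The y^j-derivative of s. As a vector it is orthogonal to y, s being homogeneous of degree 0 in
    y. *)
Definition svar_y (j : 'I_n) : V -> R := fun q =>
  q.1 0 j / enorm q.2 - svar q.1 q.2 * q.2 0 j / enorm q.2 ^+ 2.

Section RadialDerivatives.
Variables (U : set (R * R)) (f : R -> R -> R) (q : V).
Hypothesis f_smooth : smooth2 U f.
Hypothesis Uq : U (enorm q.1, svar q.1 q.2).
Hypothesis x_neq0 : q.1 != 0.
Hypothesis y_neq0 : q.2 != 0.

Lemma is_derive_radial v : is_derive q v (radial f)
  (radial (dr f) q * (dot v.1 q.1 / enorm q.1)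
   + radial (ds f) q * ((dot v.1 q.2 + dot v.2 q.1) / enorm q.2
     - svar q.1 q.2 * dot v.2 q.2 / enorm q.2 ^+ 2)).
Proof.
exact: (is_derive_comp_smooth2 (g := fun q : V => enorm q.1)
  (h := fun q : V => svar q.1 q.2) f_smooth Uq
  (is_derive_enormx v x_neq0) (is_derive_svar v y_neq0)).
Qed.

Lemma is_derive_radial_dirx j : is_derive q (dirx R j) (radial f)
  (radial (dr f) q * (q.1 0 j / enorm q.1)
   + radial (ds f) q * (q.2 0 j / enorm q.2)).
Proof.
apply: (is_derive_eq (is_derive_radial _)).
by rewrite /= !dot_delta !dot0l addr0 mulr0 mul0r subr0.
Qed.

Lemma is_derive_radial_diry j : is_derive q (diry R j) (radial f)
  (radial (ds f) q * svar_y j q).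
Proof.
apply: (is_derive_eq (is_derive_radial _)).
by rewrite /= !dot_delta !dot0l mul0r mulr0 !add0r.
Qed.

End RadialDerivatives.

Lemma is_derive_enormy_dirx j q : q.2 != 0 ->
  is_derive q (dirx R j) (fun q => enorm q.2) 0.
Proof.
move=> y0; apply: (is_derive_eq (is_derive_enormy _ y0)).
by rewrite /= dot0l mul0r.
Qed.

Lemma is_derive_enormy_diry j q : q.2 != 0 ->
  is_derive q (diry R j) (fun q => enorm q.2) (q.2 0 j / enorm q.2).
Proof.
by move=> y0; apply: (is_derive_eq (is_derive_enormy _ y0)); rewrite /= dot_delta.
Qed.

Lemma is_derive_coordy_diry i j q :
  is_derive q (diry R j) (fun q => q.2 0 i) (i == j)%:R.
Proof.
by apply: (is_derive_eq (is_derive_fiber_coord i q _)); rewrite /= mxE eqxx.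
Qed.

Lemma is_derive_coordx_diry i j q :
  is_derive q (diry R j) (fun q => q.1 0 i) 0.
Proof. by apply: (is_derive_eq (is_derive_coordx i q _)); rewrite /= mxE. Qed.

Lemma is_derive_svar_y_diry k j q : q.2 != 0 ->
  is_derive q (diry R j) (svar_y k)
    (- (q.1 0 k * q.2 0 j / enorm q.2 ^+ 3) - svar_y j q * q.2 0 k / enorm q.2 ^+ 2
     - svar q.1 q.2 * ((k == j)%:R / enorm q.2 ^+ 2
                       - 2 * q.2 0 k * q.2 0 j / enorm q.2 ^+ 4)).
Proof.
move=> y0; have u0 : enorm q.2 != 0 by rewrite gt_eqF // enorm_gt0.
have du := is_derive_enormy_diry j y0.
have dV := is_derive_inv (f := fun q : V => enorm q.2) u0 du.
have dV2 := is_derive_inv (f := fun q : V => enorm q.2 ^+ 2)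
  (expf_neq0 2 u0) (is_derive_sqr du).
have dsv : is_derive q (diry R j) (fun q => svar q.1 q.2) (svar_y j q).
  apply: (is_derive_eq (is_derive_svar (diry R j) y0)).
  by rewrite /= dot0l add0r !dot_delta.
apply: (is_derive_eq (is_derive_sub
  (is_derive_mul (is_derive_coordx_diry k j q) dV)
  (is_derive_mul (is_derive_mul dsv (is_derive_coordy_diry k j q)) dV2))).
by move: (svar_y j q) => sj; field.
Qed.

Variables (U : set (R * R)) (phi : R -> R -> R) (r0 : R) (F : V -> R).
Hypothesis phi_smooth : smooth2 U phi.
Let T := @slit_ball R n r0.
Hypothesis TU : forall q, T q -> U (enorm q.1, svar q.1 q.2).
Hypothesis FE : forall q, T q -> F q = enorm q.2 * radial phi q.

Lemma near_T q : T q -> \forall q' \near q, T q'.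
Proof. by move=> Tq; apply: open_nbhs_nbhs; split=> //; exact: open_slit_ball. Qed.

Lemma is_derive_F_dirx j q : T q -> is_derive q (dirx R j) F
  (radial (dr phi) q * (enorm q.2 * q.1 0 j / enorm q.1)
   + radial (ds phi) q * q.2 0 j).
Proof.
move=> Tq; have [x0 _ y0] := Tq.
apply: (@near_eq_is_derive _ _ _ (fun q => enorm q.2 * radial phi q)).
  by apply: filterS (near_T Tq) => q' /FE.
apply: (is_derive_eq (is_derive_mul (is_derive_enormy_dirx j y0)
  (is_derive_radial_dirx phi_smooth (TU Tq) x0 y0 j))).
by field; rewrite !gt_eqF ?enorm_gt0.
Qed.

Definition F_y (k : 'I_n) : V -> R := fun q =>
  q.2 0 k / enorm q.2 * radial phi q
  + enorm q.2 * (radial (ds phi) q * svar_y k q).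

Lemma is_derive_F_diry k q : T q -> is_derive q (diry R k) F (F_y k q).
Proof.
move=> Tq; have [x0 _ y0] := Tq.
apply: (@near_eq_is_derive _ _ _ (fun q => enorm q.2 * radial phi q)).
  by apply: filterS (near_T Tq) => q' /FE.
exact: (is_derive_mul (is_derive_enormy_diry k y0)
  (is_derive_radial_diry phi_smooth (TU Tq) x0 y0 k)).
Qed.

(** Splitting the gradient into its y and x parts reduces contractions with y and x to the scalars
    u, r and s. *)
Lemma F_yE k q : T q -> F_y k q =
  (radial phi q - svar q.1 q.2 * radial (ds phi) q) / enorm q.2 * q.2 0 k
  + radial (ds phi) q * q.1 0 k.
Proof.
move=> [_ _ y0]; rewrite /F_y /svar_y; field.
by rewrite gt_eqF // enorm_gt0.
Qed.

Lemma sum_y_F_y q : T q -> \sum_k q.2 0 k * F_y k q = enorm q.2 * radial phi q.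
Proof.
move=> Tq; have [_ _ y0] := Tq.
under eq_bigr => k _.
  rewrite F_yE // mulrDr mulrCA [X in _ + X]mulrCA [q.2 0 k * q.1 0 k]mulrC; over.
rewrite big_split /= -!mulr_sumr -/(dot _ _) -/(dot _ _) -sqr_enorm dot_svar //.
by field; rewrite gt_eqF // enorm_gt0.
Qed.

Lemma sum_x_F_y q : T q -> \sum_k q.1 0 k * F_y k q = radial (Wfun phi) q.
Proof.
move=> Tq; have [_ _ y0] := Tq.
under eq_bigr => k _.
  rewrite F_yE // mulrDr mulrCA [X in _ + X]mulrCA; over.
rewrite big_split /= -!mulr_sumr -/(dot _ _) -/(dot _ _) -sqr_enorm dot_svar //.
by rewrite /radial /Wfun; field; rewrite gt_eqF // enorm_gt0.
Qed.

(** The Hessian of F in y is a multiple of the projection orthogonal to y plus a rank one term along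
    the gradient of s; both annihilate y. *)
Lemma is_derive_F_y_diry k j q : T q -> is_derive q (diry R j) (F_y k)
  (((k == j)%:R / enorm q.2 - q.2 0 k * q.2 0 j / enorm q.2 ^+ 3) *
     (radial phi q - svar q.1 q.2 * radial (ds phi) q)
   + enorm q.2 * (radial (ds (ds phi)) q * svar_y j q * svar_y k q)).
Proof.
move=> Tq; have [x0 _ y0] := Tq.
have u0 : enorm q.2 != 0 by rewrite gt_eqF // enorm_gt0.
have du := is_derive_enormy_diry j y0.
have dV := is_derive_inv (f := fun q : V => enorm q.2) u0 du.
apply: (is_derive_eq (is_derive_add
  (is_derive_mul (is_derive_mul (is_derive_coordy_diry k j q) dV)
    (is_derive_radial_diry phi_smooth (TU Tq) x0 y0 j))
  (is_derive_mul du (is_derive_mul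
    (is_derive_radial_diry (smooth2_ds phi_smooth) (TU Tq) x0 y0 j)
    (is_derive_svar_y_diry k j y0))))).
move: (radial _ q) (radial _ q) (radial _ q) => a b c.
by rewrite /svar_y; field.
Qed.

End SphericalMetric.

(** * The rank of the fundamental tensor and the denominator of P and Q *)

Section Nondegeneracy.
Variables (R : realType) (n : nat) (r0 : R) (phi : R -> R -> R).
Variables (F : 'rV[R]_n -> 'rV[R]_n -> R) (U : set (R * R)).
Hypothesis phi_smooth : smooth2 U phi.
Hypothesis domU : forall r s, `|s| <= r < r0 -> U (r, s).
Hypothesis F_spherical : spherically_symmetric r0 phi F.

Lemma slit_ball_radial q : @slit_ball R n r0 q ->
  U (enorm q.1, svar q.1 q.2).
Proof. by move=> [_ x1 y0]; apply: domU; rewrite normr_svar_le. Qed.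

Lemma slit_ball_sphericalE q : @slit_ball R n r0 q ->
  F q.1 q.2 = enorm q.2 * radial phi q.
Proof. by move=> [_ x1 y0]; exact: (sphericalE F_spherical). Qed.

Let TU := slit_ball_radial.
Let FE := slit_ball_sphericalE.

(** This is g_jk = F_{y^j} F_{y^k} + F F_{y^j y^k}, with the Hessian of F made explicit. *)
Lemma fundamental_tensorE x y j k : @slit_ball R n r0 (x, y) ->
  let q := (x, y) in
  fundamental_tensor F x y j k = F_y phi j q * F_y phi k q
  + enorm y * radial phi q *
    (((k == j)%:R / enorm y - y 0 k * y 0 j / enorm y ^+ 3) *
       (radial phi q - svar x y * radial (ds phi) q)
     + enorm y * (radial (ds (ds phi)) q * svar_y j q * svar_y k q)).
Proof.
move=> Tq q; rewrite mxE partial_yE.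
rewrite (@near_eq_derive _ _ _ _ (fun q => 2 * F q.1 q.2 * F_y phi k q)); last first.
  apply: filterS (near_T Tq) => -[x' y'] Tq'; rewrite partial_yE /=.
  apply: derive_val.
  exact: (is_derive_sqr (is_derive_F_diry phi_smooth TU FE k Tq')).
have dF := is_derive_F_diry phi_smooth TU FE j Tq.
have dFy := is_derive_F_y_diry phi_smooth TU k j Tq.
have [_ ->] := is_derive_mul (is_derive_mul (is_derive_const 2 q (diry R j)) dF) dFy.
have [_ _ y0] := Tq.
by rewrite (FE Tq) /=; field; rewrite gt_eqF // enorm_gt0.
Qed.

Hypothesis n_ge2 : (2 <= n)%N.
Hypothesis F_metric : finsler_metric r0 F.

(* At y = e_0 and x = s e_0 + t e_1 with s^2 + t^2 = r^2, the y-Hessian of F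
   kills e_0 and scales e_1 by Dfun; if Dfun vanishes then the fundamental
   tensor kills F_{y^0} e_1 - F_{y^1} e_0. *)
Lemma Dfun_neq0 r s : 0 < r -> `|s| <= r < r0 -> Dfun phi r s != 0.
Proof.
move=> r_gt0 rs; apply/eqP => D0; have [sr rr0] := andP rs.
pose i0 := Ordinal (ltnW n_ge2); pose i1 := Ordinal n_ge2.
have t2 : 0 <= r ^+ 2 - s ^+ 2.
  by rewrite subr_ge0 -[s ^+ 2]real_normK ?num_real // ler_pXn2r // nnegrE // ltW.
(* This value of [t] gives x the length [r]. On the boundary |s| = r it is 0 and x is a multiple of
   y, a case the argument admits. *)
pose t := Num.sqrt (r ^+ 2 - s ^+ 2).
have tE : t ^+ 2 = r ^+ 2 - s ^+ 2 by rewrite sqr_sqrtr.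
pose y : 'rV[R]_n := delta_mx 0 i0.
pose x : 'rV[R]_n := s *: delta_mx 0 i0 + t *: delta_mx 0 i1.
have yE k : y 0 k = (k == i0)%:R by rewrite mxE eqxx.
have xE k : x 0 k = s * (k == i0)%:R + t * (k == i1)%:R by rewrite !mxE eqxx.
have i10 : (i1 == i0) = false by [].
have xi0 : x 0 i0 = s by rewrite xE eqxx eq_sym i10 mulr1 mulr0 addr0.
have xi1 : x 0 i1 = t by rewrite xE eqxx i10 mulr1 mulr0 add0r.
have u1 : enorm y = 1 by rewrite /enorm dot_delta yE eqxx sqrtr1.
have xr : enorm x = r.
  rewrite /enorm /x dotDl !dotZl !dot_delta -/x xi0 xi1.
  rewrite -!expr2 tE subrKC sqrtr_sqr.
  by rewrite ger0_norm // ltW.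
have xs : svar x y = s.
  by rewrite /svar u1 divr1 dotC dot_delta xi0.
have y0 : y != 0 by rewrite -enorm_gt0 u1.
have Tq : @slit_ball R n r0 (x, y).
  by split=> //=; [rewrite -enorm_gt0 xr|rewrite xr].
have sy k : svar_y k (x, y) = t * (k == i1)%:R.
  by rewrite /svar_y /= u1 xs xE yE; field.
have FyE : F_y phi i0 (x, y) = phi r s.
  by rewrite /F_y sy /radial /= xr xs u1 yE eqxx /= !mulr0 addr0 divr1 mul1r.
have g0 j : fundamental_tensor F x y j i0 = F_y phi j (x, y) * phi r s.
  rewrite (fundamental_tensorE j i0 Tq) FyE !sy u1 !yE eqxx (eq_sym i0 j).
  by rewrite (eq_sym i0 i1) i10 mulr0n mulr1n; field.
have g1 j : fundamental_tensor F x y j i1 = F_y phi j (x, y) * F_y phi i1 (x, y).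
  rewrite (fundamental_tensorE j i1 Tq) !sy u1 !yE eqxx /= expr1n !divr1 !mul1r.
  rewrite mul0r subr0 mulr1 xs /radial /= xr xs.
  (* The projection part contributes phi - s phi_s and the rank one part t^2 phi_ss; with t^2 = r^2
     - s^2 they add up to [Dfun]. *)
  have -> : (i1 == j)%:R * (phi r s - s * ds phi r s)
      + ds (ds phi) r s * (t * (j == i1)%:R) * t = (j == i1)%:R * Dfun phi r s.
    by rewrite /Dfun -tE eq_sym; ring.
  by rewrite D0 !mulr0 addr0.
pose g := fundamental_tensor F x y.
pose v : 'cV[R]_n := phi r s *: delta_mx i1 0 - F_y phi i1 (x, y) *: delta_mx i0 0.
have gu : g \in unitmx.
  rewrite -row_free_unit /row_free; apply/eqP.
  by apply: (finsler_rank F_metric) => //; rewrite xr.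
have gv : g *m v = 0.
  have {g0}g0 j : g j i0 = F_y phi j (x, y) * phi r s by exact: g0.
  have {g1}g1 j : g j i1 = F_y phi j (x, y) * F_y phi i1 (x, y) by exact: g1.
  clearbody g; rewrite mulmxBr -!scalemxAr -!colE; apply/matrixP => j k.
  by rewrite !mxE g0 g1; ring.
have : v = 0 by rewrite -[v](mulKmx gu) gv mulmx0.
move=> /matrixP /(_ i1 0); rewrite !mxE eqxx /= mulr1 mulr0 subr0 => /eqP.
by apply/negP; rewrite gt_eqF // (spherical_pos F_spherical).
Qed.

End Nondegeneracy.

(** * The spray coefficients and the parallelism of F *)

Lemma sum_combination (K : comNzRingType) n (c d : K) (x y z : 'I_n -> K) :
  \sum_i (c * y i + d * x i) * z i = c * \sum_i y i * z i + d * \sum_i x i * z i.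
Proof.
by rewrite !mulr_sumr -big_split; apply: eq_bigr => i _; rewrite mulrDl !mulrA.
Qed.

Lemma sum_delta_combination (K : comNzRingType) n (a c d : K)
    (x y z : 'I_n -> K) j :
  \sum_i ((i == j)%:R * a + c * y i + d * x i) * z i =
  a * z j + c * \sum_i y i * z i + d * \sum_i x i * z i.
Proof.
rewrite -addrA -sum_combination.
have -> : a * z j = \sum_i (i == j)%:R * a * z i.
  rewrite (bigD1 j) //= eqxx mul1r big1 ?addr0 // => i /negbTE ->.
  by rewrite !mul0r.
by rewrite -big_split; apply: eq_bigr => i _; rewrite -addrA mulrDl.
Qed.

Section Spray.
Variables (R : realType) (n : nat) (r0 : R) (phi : R -> R -> R).
Local Notation V := ('rV[R]_n * 'rV[R]_n)%type.
Variables (F : V -> R) (U : set (R * R)).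
Hypothesis Uopen : open U.
Hypothesis phi_smooth : smooth2 U phi.
Hypothesis r_neq0 : forall r s, U (r, s) -> r != 0.
Hypothesis phi_neq0 : forall r s, U (r, s) -> phi r s != 0.
Hypothesis D_neq0 : forall r s, U (r, s) -> Dfun phi r s != 0.
Let T := @slit_ball R n r0.
Hypothesis TU : forall q, T q -> U (enorm q.1, svar q.1 q.2).
Hypothesis FE : forall q, T q -> F q = enorm q.2 * radial phi q.

Let P := Defs.Pfun phi.
Let Q := Defs.Qfun phi.
Let P_smooth := smooth2_P Uopen phi_smooth r_neq0 phi_neq0 D_neq0.
Let Q_smooth := smooth2_Q Uopen phi_smooth r_neq0 D_neq0.

Definition spray_q (i : 'I_n) : V -> R := fun q => spray_coef phi i q.1 q.2.

Lemma derivable_spray_q i q v : T q -> derivable (spray_q i) q v.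
Proof.
move=> Tq; have [x0 _ y0] := Tq.
have du := is_derive_enormy v y0.
have dP := is_derive_radial P_smooth (TU Tq) x0 y0 v.
have dQ := is_derive_radial Q_smooth (TU Tq) x0 y0 v.
by have [] := is_derive_add
  (is_derive_mul (is_derive_mul du dP) (is_derive_fiber_coord i q v))
  (is_derive_mul (is_derive_mul (is_derive_sqr du) dQ) (is_derive_coordx i q v)).
Qed.

(** G^i_j is arranged as a multiple of the identity plus multiples of y^i and x^i, the shape that
    [sum_delta_combination] contracts with F_{y^i}. *)
Definition spray_qy (i j : 'I_n) : V -> R := fun q =>
  (i == j)%:R * (enorm q.2 * radial P q)
  + (q.2 0 j / enorm q.2 * radial P q
     + enorm q.2 * (radial (ds P) q * svar_y j q)) * q.2 0 i
  + (2 * q.2 0 j * radial Q q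
     + enorm q.2 ^+ 2 * (radial (ds Q) q * svar_y j q)) * q.1 0 i.

Lemma is_derive_spray_q i j q : T q ->
  is_derive q (diry R j) (spray_q i) (spray_qy i j q).
Proof.
move=> Tq; have [x0 _ y0] := Tq.
have du := is_derive_enormy_diry j y0.
have dP := is_derive_radial_diry P_smooth (TU Tq) x0 y0 j.
have dQ := is_derive_radial_diry Q_smooth (TU Tq) x0 y0 j.
apply: (is_derive_eq (is_derive_add
  (is_derive_mul (is_derive_mul du dP) (is_derive_coordy_diry i j q))
  (is_derive_mul (is_derive_mul (is_derive_sqr du) dQ)
     (is_derive_coordx_diry i j q)))).
rewrite /spray_qy -/P -/Q.
move: (radial P q) (radial Q q) (radial (ds P) q) (radial (ds Q) q) (svar_y j q).
by move=> p q' ps qs sj; field; rewrite gt_eqF // enorm_gt0.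
Qed.

(** Near [q] the derivative agrees with the explicit [spray_qy], all of whose factors are derivable.
    Only derivability is kept: the derivatives of G^i_j cancel later without being evaluated. *)
Lemma derivable_spray_qy i j q v : T q ->
  derivable ('D_(diry R j) (spray_q i)) q v.
Proof.
move=> Tq; have [x0 _ y0] := Tq.
have u0 : enorm q.2 != 0 by rewrite gt_eqF // enorm_gt0.
apply: (@near_eq_derivable _ _ _ (spray_qy i j)).
  apply: filterS (near_T Tq) => q' Tq'; apply/esym/derive_val.
  exact: is_derive_spray_q.
have du := is_derive_enormy v y0.
have dP := is_derive_radial P_smooth (TU Tq) x0 y0 v.
have dQ := is_derive_radial Q_smooth (TU Tq) x0 y0 v.
have dPs := is_derive_radial (smooth2_ds P_smooth) (TU Tq) x0 y0 v.
have dQs := is_derive_radial (smooth2_ds Q_smooth) (TU Tq) x0 y0 v.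
have dx k := is_derive_coordx k q v.
have dy k := is_derive_fiber_coord k q v.
have dV := is_derive_inv (f := fun q : V => enorm q.2) u0 du.
have dV2 := is_derive_inv (f := fun q : V => enorm q.2 ^+ 2)
  (expf_neq0 2 u0) (is_derive_sqr du).
have dc c := is_derive_const c q v.
have dsj := is_derive_sub (is_derive_mul (dx j) dV)
  (is_derive_mul (is_derive_mul (is_derive_svar v y0) (dy j)) dV2).
by have [] := is_derive_add (is_derive_add
  (is_derive_mul (dc (i == j)%:R) (is_derive_mul du dP))
  (is_derive_mul (is_derive_add (is_derive_mul (is_derive_mul (dy j) dV) dP)
    (is_derive_mul du (is_derive_mul dPs dsj))) (dy i)))
  (is_derive_mul (is_derive_add (is_derive_mul (is_derive_mul (dc 2) (dy j)) dQ)
    (is_derive_mul (is_derive_sqr du) (is_derive_mul dQs dsj))) (dx i)).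
Qed.

(** The difference of the two sides is u x_j E1 + y_j (E2 - s E1), where E2 = 0 is [radial_spray]
    and E1 = 0 is [radial_horizontal]. *)
Lemma spray_parallel j q : T q ->
  'D_(dirx R j) F q = \sum_(i < n) 'D_(diry R j) (spray_q i) q * 'D_(diry R i) F q.
Proof.
move=> Tq; have [x0 _ y0] := Tq.
have [_ ->] := is_derive_F_dirx phi_smooth TU FE j Tq.
have -> : \sum_(i < n) 'D_(diry R j) (spray_q i) q * 'D_(diry R i) F q =
    \sum_(i < n) spray_qy i j q * F_y phi i q.
  apply: eq_bigr => i _; have [_ ->] := is_derive_spray_q i j Tq.
  by have [_ ->] := is_derive_F_diry phi_smooth TU FE i Tq.
rewrite sum_delta_combination (sum_y_F_y phi Tq) (sum_x_F_y phi Tq).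
rewrite (F_yE phi j Tq).
have := radial_horizontal Uopen phi_smooth r_neq0 phi_neq0 D_neq0 (TU Tq).
have := radial_spray r_neq0 phi_neq0 (TU Tq).
have : enorm q.1 != 0 by rewrite gt_eqF // enorm_gt0.
have : enorm q.2 != 0 by rewrite gt_eqF // enorm_gt0.
rewrite -/P -/Q /radial /svar_y.
move: (enorm q.1) (enorm q.2) (svar q.1 q.2) => r u s.
move: (P r s) (Q r s) (ds P r s) (ds Q r s) (Wfun phi r s) (phi r s)
  (dr phi r s) (ds phi r s) (q.1 0 j) (q.2 0 j).
move=> p k ps ks w f fr fs xj yj u0 r0' E2 E1.
apply/eqP; rewrite -subr_eq0; apply/eqP.
transitivity (u * xj * (fr / r - (p * fs + ps * f) - w * ks)
  + yj * ((fs + s / r * fr - 2 * p * f - 2 * k * w)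
          - s * (fr / r - (p * fs + ps * f) - w * ks))).
  by field; rewrite u0 r0'.
by rewrite E1 E2 !mulr0 subr0 mulr0 addr0.
Qed.

(** The difference of the two sides is u^2 times the left side of [radial_spray]. *)
Lemma spray_geodesic q : T q ->
  \sum_(k < n) q.2 0 k * 'D_(dirx R k) F q =
  2 * \sum_(i < n) spray_q i q * 'D_(diry R i) F q.
Proof.
move=> Tq; have [x0 _ y0] := Tq.
have -> : \sum_(i < n) spray_q i q * 'D_(diry R i) F q =
    \sum_(i < n) (enorm q.2 * radial P q * q.2 0 i
      + enorm q.2 ^+ 2 * radial Q q * q.1 0 i) * F_y phi i q.
  apply: eq_bigr => i _.
  by have [_ ->] := is_derive_F_diry phi_smooth TU FE i Tq.
have -> : \sum_(k < n) q.2 0 k * 'D_(dirx R k) F q =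
    \sum_(k < n) (radial (ds phi) q * q.2 0 k
      + radial (dr phi) q * enorm q.2 / enorm q.1 * q.1 0 k) * q.2 0 k.
  apply: eq_bigr => k _.
  have [_ ->] := is_derive_F_dirx phi_smooth TU FE k Tq.
  move: (radial _ q) (radial _ q) => a b.
  by field; rewrite gt_eqF // enorm_gt0.
rewrite !sum_combination (sum_y_F_y phi Tq) (sum_x_F_y phi Tq).
rewrite -/(dot _ _) -/(dot _ _) -sqr_enorm dot_svar //.
have := radial_spray r_neq0 phi_neq0 (TU Tq).
have : enorm q.1 != 0 by rewrite gt_eqF // enorm_gt0.
rewrite -/P -/Q /radial.
move: (enorm q.1) (enorm q.2) (svar q.1 q.2) => r u s.
move: (P r s) (Q r s) (Wfun phi r s) (phi r s) (dr phi r s) (ds phi r s).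
move=> p k w f fr fs r0' E2.
apply/eqP; rewrite -subr_eq0; apply/eqP.
transitivity (u ^+ 2 * (fs + s / r * fr - 2 * p * f - 2 * k * w)).
  by field.
by rewrite E2 mulr0.
Qed.

End Spray.

(** * Vanishing of the one-form and the equivalence *)

Lemma curvature_terms_eq (K : nzRingType) (a b c d b' c' d' : K) :
  b = b' -> c = c' -> d = d' -> a - (b - 2 * c) - d = a - (b' - 2 * c') - d'.
Proof. by move=> -> -> ->. Qed.

(** The curried partial derivatives defining the curvature are matched, sum by sum, with directional
    derivatives on the product space, where [curvature_annihilates] applies. *)
Lemma d_R_spherical_eq0 (R : realType) (n : nat) (r0 : R) (phi : R -> R -> R)
    (F : 'rV[R]_n -> 'rV[R]_n -> R) (U : set (R * R)) (x y : 'rV[R]_n) j :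
  open U -> smooth2 U phi ->
  (forall r s, U (r, s) -> [/\ r != 0, phi r s != 0 & Dfun phi r s != 0]) ->
  (forall q, @slit_ball R n r0 q -> U (enorm q.1, svar q.1 q.2)) ->
  (forall q, @slit_ball R n r0 q -> F q.1 q.2 = enorm q.2 * radial phi q) ->
  Coo (@slit_ball R n r0) (fun q => F q.1 q.2) ->
  slit_ball r0 (x, y) -> d_R phi F j x y = 0.
Proof.
move=> Uo cphi Unz TU FE cF Txy.
have r_nz r s : U (r, s) -> r != 0 by case/Unz.
have f_nz r s : U (r, s) -> phi r s != 0 by case/Unz.
have D_nz r s : U (r, s) -> Dfun phi r s != 0 by case/Unz.
have := curvature_annihilates (@open_slit_ball R n r0) cF
  (fun i q v => derivable_spray_q (r0 := r0) (i := i) (v := v)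
     Uo cphi r_nz f_nz D_nz TU)
  (fun i k q v => derivable_spray_qy (r0 := r0) (i := i) (j := k) (v := v)
     Uo cphi r_nz f_nz D_nz TU)
  (spray_parallel Uo cphi r_nz f_nz D_nz TU FE)
  (spray_geodesic cphi r_nz f_nz TU FE) j Txy.
have NE i k : (fun q : 'rV[R]_n * 'rV[R]_n => connection_coef phi i k q.1 q.2)
    = 'D_(diry R k) (spray_q phi i).
  by apply/funext => -[x' y']; rewrite /connection_coef partial_yE.
have RE i : riemann_curvature phi i j x y = 2 * 'D_(dirx R j) (spray_q phi i) (x, y)
    - (\sum_(k < n) y 0 k * 'D_(dirx R k) ('D_(diry R j) (spray_q phi i)) (x, y)
       - 2 * \sum_(k < n) spray_q phi k (x, y) *
           'D_(diry R k) ('D_(diry R j) (spray_q phi i)) (x, y))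
    - \sum_(k < n) 'D_(diry R k) (spray_q phi i) (x, y)
        * 'D_(diry R j) (spray_q phi k) (x, y).
  have e1 : \sum_(k < n) y 0 k * partial_x k (connection_coef phi i j) x y =
      \sum_(k < n) y 0 k * 'D_(dirx R k) ('D_(diry R j) (spray_q phi i)) (x, y).
    by apply: eq_bigr => k _; rewrite -NE partial_xE.
  have e2 : \sum_(k < n) spray_coef phi k x y
        * partial_y k (connection_coef phi i j) x y =
      \sum_(k < n) spray_q phi k (x, y)
        * 'D_(diry R k) ('D_(diry R j) (spray_q phi i)) (x, y).
    by apply: eq_bigr => k _; rewrite -NE partial_yE.
  have e3 : \sum_(k < n) connection_coef phi i k x y * connection_coef phi k j x y =
      \sum_(k < n) 'D_(diry R k) (spray_q phi i) (x, y)
        * 'D_(diry R j) (spray_q phi k) (x, y).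
    by apply: eq_bigr => k _; rewrite /connection_coef !partial_yE.
  have e0 : partial_x j (spray_coef phi i) x y = 'D_(dirx R j) (spray_q phi i) (x, y).
    exact: partial_xE.
  rewrite /riemann_curvature e0 /spray.
  exact: curvature_terms_eq e1 e2 e3.
by apply: etrans; apply: eq_bigr => i _; rewrite RE partial_yE.
Qed.

Set Strict Implicit.
Unset Implicit Arguments.

Theorem proposition1 (R : realType) (n : nat) (r0 : R) (phi : R -> R -> R)
    (F : 'rV[R]_n -> 'rV[R]_n -> R)
    (hn : (2 <= n)%N) (hr0 : 0 < r0)
    (hF : finsler_metric r0 F) (hphi : spherically_symmetric r0 phi F) :
  let compat r s :=
    ds phi r s * R1fun phi r s
    + (s * phi r s + (r ^+ 2 - s ^+ 2) * ds phi r s) * R3fun phi r s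
    + phi r s * R5fun phi r s = 0 in
  [/\ forall x y : 'rV[R]_n, x != 0 -> enorm x < r0 -> y != 0 ->
        forall j : 'I_n, d_R phi F j x y = 0,
      forall r s : R, 0 < r -> `|s| <= r < r0 -> compat r s
    & forall x y : 'rV[R]_n, x != 0 -> enorm x < r0 -> y != 0 ->
        (forall j : 'I_n, d_R phi F j x y = 0) <->
        compat (enorm x) (svar x y)].
Proof.
move=> compat.
have [U [Uo dU] itU] := spherical_smooth hphi.
have cU : smooth2 U phi := Coo_iter_derive itU.
have domU r s : `|s| <= r < r0 -> U (r, s) by move=> rs; exact: dU.
have D_nz := Dfun_neq0 cU domU hphi hn hF.
(* phi, its derivatives and Qfun are only controlled on an open neighbourhood of
   the closed cone |s| <= r; P and Q are smooth where, moreover, no denominator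
   vanishes. *)
pose W := [set p : R * R |
  [/\ U p, p.1 != 0, phi p.1 p.2 != 0 & Dfun phi p.1 p.2 != 0]]°.
have W_U : W `<=` [set p : R * R |
  [/\ U p, p.1 != 0, phi p.1 p.2 != 0 & Dfun phi p.1 p.2 != 0]].
  exact: interior_subset.
have Wo : open W by exact: open_interior.
have cW : smooth2 W phi by apply: Coo_subset cU => p /W_U[].
(* Nonvanishing is an open condition, so each point of the closed cone with r > 0, boundary
   included, has a full neighbourhood in [W]; two-sided derivatives at |s| = r are thus
   legitimate. *)
have domW r s : 0 < r -> `|s| <= r < r0 -> W (r, s).
  move=> r_gt0 rs; have Urs := domU _ _ rs; rewrite /W /interior /=.
  have nU : \forall p \near (r, s), U p by exact: open_nbhs_nbhs.
  have n1 : \forall p \near (r, s), p.1 != 0.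
    by apply: (Coo_near_neq0 (smooth2_fst Uo) Urs); rewrite gt_eqF.
  have n2 : \forall p \near (r, s), phi p.1 p.2 != 0.
    by apply: (Coo_near_neq0 cU Urs); rewrite gt_eqF // (spherical_pos hphi).
  have n3 : \forall p \near (r, s), Dfun phi p.1 p.2 != 0.
    by apply: (Coo_near_neq0 (smooth2_D Uo cU) Urs); exact: D_nz.
  by apply: filterS3 (filterI nU n1) n2 n3 => p [? ?] ? ?; split.
have Wnz r s : W (r, s) -> [/\ r != 0, phi r s != 0 & Dfun phi r s != 0].
  by move=> Wrs; have [] := W_U _ Wrs.
have TW (q : 'rV[R]_n * 'rV[R]_n) : slit_ball r0 q -> W (enorm q.1, svar q.1 q.2).
  move=> [x0 x1 y0]; apply: domW; first by rewrite enorm_gt0.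
  by rewrite normr_svar_le.
have cF : Coo (@slit_ball R n r0) (fun q => F q.1 q.2).
  have [UF [_ dUF] itF] := finsler_smooth hF.
  by apply: Coo_subset (Coo_iter_derive itF) => q [_ x1 y0]; exact: dUF.
have curv x y : x != 0 -> enorm x < r0 -> y != 0 ->
    forall j, d_R phi F j x y = 0.
  move=> x0 x1 y0 j; have FE := slit_ball_sphericalE hphi.
  exact: (d_R_spherical_eq0 j Wo cW Wnz TW FE cF).
have compat0 r s : 0 < r -> `|s| <= r < r0 -> compat r s.
  move=> r_gt0 rs; have Wrs := domW _ _ r_gt0 rs.
  apply: (radial_compatibility Wo cW _ _ _ Wrs) => r' s' /Wnz[] //.
split=> // x y x0 x1 y0; split=> [_|_]; last exact: curv.
by apply: compat0; rewrite ?enorm_gt0 // normr_svar_le.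
Qed.
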